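(* Let $d\ge1$, $0<\sigma<\infty$, $\omega>0$ and assume that $\varphi_\omega$ is a limit wave, with associated sequence $\delta_j\to0$ and waves $\varphi_{\omega+\delta_j}$. Assume also that $\varphi_\omega$ is non-degenerate, in the sense that $$\mathrm{Ker}\big(-\Delta_{disc}+\omega-(2\sigma+1)\varphi_\omega^{2\sigma}\big)=\{0\}.$$ Then the solution $e^{i\omega t}\varphi_\omega$ of the DNLS equation is spectrally stable if $$\lim_{\delta_j\to0}\frac{\|\varphi_{\omega+\delta_j}\|_{l^2}^2-\|\varphi_\omega\|_{l^2}^2}{\delta_j}\ge0,$$ and it is unstable if $$\lim_{\delta_j\to0}\frac{\|\varphi_{\omega+\delta_j}\|_{l^2}^2-\|\varphi_\omega\|_{l^2}^2}{\delta_j}<0.$$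
   Context: The discrete Laplacian on $\mathbb Z^d$ is $(\Delta_{disc}\mathbf u)_n=\sum_{j\in\mathbb Z^d:|j-n|=1}u_j-2d\,u_n$. The focusing DNLS equation is $i\partial_tu_n+(\Delta_{disc}u)_n+|u_n|^{2\sigma}u_n=0$, $n\in\mathbb Z^d$. For $\omega>0$ and $\mathbf u\in l^2(\mathbb Z^d)$ let $J_\omega[\mathbf u]=\sum_{|j-n|=1}|u_j-u_n|^2+\omega\sum_n|u_n|^2$, the first sum running over unordered nearest-neighbour pairs (so it equals $\langle-\Delta_{disc}\mathbf u,\mathbf u\rangle$), and let $j(\omega)=\inf\{J_\omega[\mathbf u]:\|\mathbf u\|_{l^{2\sigma+2}}=1\}>0$. The minimizers of this problem considered here have non-negative entries. A sequence $\mathbf u_\omega$ is a limit wave if there exist a sequence of nonzero reals $\delta_j\to0$ and minimizers $\mathbf u_{\omega+\delta_j}$ of $J_{\omega+\delta_j}$ subject to $\|\mathbf u\|_{l^{2\sigma+2}}=1$ such that $\lim_j\|\mathbf u_{\omega+\delta_j}-\mathbf u_\omega\|_{l^2}=0$. (Such $\mathbf u_\omega$ is itself a constrained minimizer of $J_\omega$.) The corresponding waves $\varphi_\omega=j(\omega)^{\frac1{2\sigma}}\mathbf u_\omega$, which solve $-\Delta_{disc}\varphi+\omega\varphi-\varphi^{2\sigma+1}=0$, are also called limit waves; likewise $\varphi_{\omega+\delta_j}=j(\omega+\delta_j)^{\frac1{2\sigma}}\mathbf u_{\omega+\delta_j}$. Set $\mathcal L_+=-\Delta_{disc}+\omega-(2\sigma+1)\varphi_\omega^{2\sigma}$,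 $\mathcal L_-=-\Delta_{disc}+\omega-\varphi_\omega^{2\sigma}$ on $l^2(\mathbb Z^d)$. The wave $e^{i\omega t}\varphi_\omega$ is spectrally stable if $$\begin{pmatrix}0&-1\\1&0\end{pmatrix}\begin{pmatrix}\mathcal L_+&0\\0&\mathcal L_-\end{pmatrix}\mathbf v=\mu\,\mathbf v$$ has no non-trivial solution $(\mu,\mathbf v)$ with $\Re\mu>0$ and $\mathbf v\in l^2(\mathbb Z^d)\times l^2(\mathbb Z^d)$ (complex-valued); otherwise it is unstable. *)

(* Defs.v *)
From HB Require Import structures.
From mathcomp Require Import all_boot all_order all_algebra.
From mathcomp Require Import all_classical all_reals all_analysis.
From mathcomp Require Import complex.
Set Implicit Arguments.
Unset Strict Implicit.
Unset Printing Implicit Defensive.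
Import Order.TTheory GRing.Theory Num.Theory.
Import numFieldNormedType.Exports.
Local Open Scope classical_set_scope.
Local Open Scope complex_scope.
Local Open Scope ring_scope.

Notation lattice d := 'rV[int]_d.

(* |m - n| = 1 for the Euclidean norm, squared so as to stay in int. *)
Definition adjacent (d : nat) (m n : lattice d) : Prop :=
  \sum_(i < d) (m 0 i - n 0 i) ^+ 2 = 1.

Definition laplacian (d : nat) (V : zmodType) (u : lattice d -> V)
    (n : lattice d) : V :=
  \sum_(m \in [set m | adjacent m n]) u m - u n *+ (2 * d).

Section RealSequences.
Variables (R : realType) (d : nat).
Implicit Types (u v phi : lattice d -> R) (s w p : R).

Definition mem_lp p u : Prop :=
  summable [set: lattice d] (fun n => (`|u n| `^ p)%:E).

(* Meaningful only when [mem_lp p u]: [fine] sends a divergent sum to 0. *)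
Definition lp_norm p u : R :=
  (fine (\esum_(n in [set: lattice d]) (`|u n| `^ p)%:E)) `^ p^-1.

(* The sum runs over ordered pairs, hence counts every nearest-neighbour pair
   twice. *)
Definition dirichlet_energy u : R :=
  2^-1 * fine (\esum_(e in [set e : lattice d * lattice d | adjacent e.1 e.2])
                 (`|u e.1 - u e.2| ^+ 2)%:E).

Definition J w u : R := dirichlet_energy u + w * lp_norm 2 u ^+ 2.

Definition admissible s u : Prop :=
  mem_lp 2 u /\ lp_norm (2 * s + 2) u = 1.

Definition J_inf s w : R := inf [set J w u | u in admissible s].

Definition nonneg_minimizer s w u : Prop :=
  [/\ admissible s u, J w u = J_inf s w & forall n, 0 <= u n].

Definition limit_sequence s w (delta : nat -> R) (us : nat -> lattice d -> R) u
    : Prop :=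
  [/\ (forall k, delta k != 0) /\ (delta k @[k --> \oo] --> (0 : R)),
      forall k, 0 < w + delta k,
      forall k, nonneg_minimizer s (w + delta k) (us k),
      mem_lp 2 u
    & lp_norm 2 (us k \- u) @[k --> \oo] --> (0 : R)].

Definition wave s w u : lattice d -> R :=
  fun n => J_inf s w `^ (2 * s)^-1 * u n.

Definition limit_wave s w (delta : nat -> R) (phis : nat -> lattice d -> R) phi
    : Prop :=
  exists (us : nat -> lattice d -> R) (u : lattice d -> R),
    [/\ limit_sequence s w delta us u,
        phi = wave s w u
      & forall k, phis k = wave s (w + delta k) (us k)].

End RealSequences.

Section Linearization.
Variables (R : realType) (d : nat).
Implicit Types (phi : lattice d -> R) (v : lattice d -> R[i]) (s w : R).

Definition mem_l2C v : Prop := mem_lp 2 (fun n => ComplexField.Normc.normc (v n)).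

Definition Lplus s w phi v (n : lattice d) : R[i] :=
  - laplacian v n + w%:C * v n - ((2 * s + 1) * phi n `^ (2 * s))%:C * v n.

Definition Lminus s w phi v (n : lattice d) : R[i] :=
  - laplacian v n + w%:C * v n - (phi n `^ (2 * s))%:C * v n.

Definition nondegenerate_wave s w phi : Prop :=
  [set v | mem_l2C v /\ Lplus s w phi v = cst 0] = [set cst 0].

(* (0 -1; 1 0) diag(L_+, L_-) (v1, v2) = (- L_- v2, L_+ v1). *)
Definition linearized_eigenpair s w phi (mu : R[i])
    (v : (lattice d -> R[i]) * (lattice d -> R[i])) : Prop :=
  [/\ mem_l2C v.1, mem_l2C v.2,
      v <> (cst 0, cst 0),
      forall n, - Lminus s w phi v.2 n = mu * v.1 n
    & forall n, Lplus s w phi v.1 n = mu * v.2 n].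

Definition spectrally_stable s w phi : Prop :=
  ~ exists (mu : R[i]) (v : (lattice d -> R[i]) * (lattice d -> R[i])),
    0 < complex.Re mu /\ linearized_eigenpair s w phi mu v.

Definition spectrally_unstable s w phi : Prop := ~ spectrally_stable s w phi.

End Linearization.

(* Main.v *)
Require Import Defs.
From HB Require Import structures.
From mathcomp Require Import all_boot all_order all_algebra.
From mathcomp Require Import all_classical all_reals all_analysis.
From mathcomp Require Import finmap complex zify ring lra.
Set Implicit Arguments.
Unset Strict Implicit.
Unset Printing Implicit Defensive.
Import Order.TTheory GRing.Theory Num.Theory.
Import numFieldNormedType.Exports.
Local Open Scope classical_set_scope.
Local Open Scope ring_scope.

(** Write [phi] for the limit wave, [L+] and [L-] for the two linearized
    operators, and [A = - Delta + omega].  Everything takes place in the real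
    Hilbert space of square summable functions on the lattice; a complex
    eigenpair is split into its real and imaginary parts.

    Slope.  Put [r_k = (phi_(omega + delta_k) - phi) / delta_k].  Subtracting
    the equations of the two waves gives [L+ r_k = - phi_(omega + delta_k)] up
    to an error which is [o(|r_k|)].  The kernel of [L+] is trivial and [L+] is
    a coercive operator minus multiplication by a function vanishing at
    infinity, hence [L+] is bounded below
    ([coercive_of_trivial_kernel] applied to the square of [L+]).  So [r_k] is
    bounded, any weak limit [y] solves [L+ y = - phi], and the lower bound turns
    weak convergence along one ultrafilter into strong convergence of the whole
    sequence.  Therefore the limit of the difference quotients of the squared
    norms exists and equals [2 <y, phi>] ([limit_wave_slope]).

    Variational input.  The limit wave is again a positive minimizer
    ([limit_admissible], [limit_energy], [minimizer_gt0]).  The second variation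
    along curves which preserve the constraint exactly shows that [L+] is
    nonnegative on the orthogonal of [psi = phi^(2 sigma + 1)]
    ([minimizer_wave_index]), while [L+ phi = - 2 sigma psi].  Since [phi] is a
    positive solution of [L- phi = 0], a sum-of-squares identity over the edges
    of the lattice shows that [L-] is nonnegative with kernel spanned by [phi]
    ([ground_state_identity], [Lop_psd], [Lop_ker]).

    Stability.  If [<y, phi> >= 0], then [L+ >= 0] on the orthogonal of [phi]
    ([vk_nonneg]), and this forbids eigenvalues with positive real part
    ([no_unstable_mode]).

    Instability.  If [<y, phi> < 0], then [L+] takes a negative value on the
    orthogonal of [phi].  Let [m] be the least number for which
    [<L+ L- z, L- z> + m <L- z, z>] is nonnegative for all [z].  It is positive,
    and the corresponding operator must have a kernel element beyond [phi],
    since otherwise it would be coercive modulo [phi] and [m] could be lowered.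
    That element gives [L- L+ x = - m x] with [x <> 0], i.e. the real eigenvalue
    [sqrt m] ([vk_growing_mode]). *)

(** * Unconditional real sums *)

Section Sums.
Variables (R : realType) (T : choiceType).
Implicit Types (f g h : T -> R) (s : seq T).

Definition summ f := summable [set: T] (EFin \o f).

Definition psum f : R := fine (\esum_(n in [set: T]) (f n)%:E).

(** Meaningful when [summ f] holds: an infinite part would be read as 0. *)
Definition tsum f : R :=
  psum (fun n => Num.max (f n) 0) - psum (fun n => Num.max (- f n) 0).

Lemma psumE f : (forall n, 0 <= f n) -> summ f ->
  \esum_(n in [set: T]) (f n)%:E = (psum f)%:E.
Proof.
move=> f0 sf; rewrite fineK//; move: sf; rewrite /summ summableE.
congr (_ \is a fin_num); apply: eq_esum => n _ /=.
by rewrite ger0_norm.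
Qed.

Lemma summ_le f g : (forall n, `|f n| <= `|g n|) -> summ g -> summ f.
Proof.
by move=> fg; apply: le_lt_trans; apply: le_esum => n _ /=; rewrite lee_fin.
Qed.

Lemma summD f g : summ f -> summ g -> summ (fun n => f n + g n).
Proof. by move=> sf sg; have := summableD sf sg. Qed.

Lemma summN f : summ f -> summ (fun n => - f n).
Proof. by apply: summ_le => n; rewrite normrN. Qed.

Lemma summ_of_bounded f : (exists M, forall s, uniq s -> \sum_(n <- s) `|f n| <= M) ->
  summ f.
Proof.
move=> [M fM]; rewrite /summ/summable (@le_lt_trans _ _ M%:E) ?ltry//.
apply: ge_ereal_sup => _ [X [finX _] <-].
rewrite fsbig_finite//= sumEFin lee_fin; exact: fM (fset_uniq _).
Qed.

Lemma psum_le_ub f M : (forall n, 0 <= f n) ->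
  (forall s, uniq s -> \sum_(n <- s) f n <= M) -> psum f <= M.
Proof.
move=> f0 fM; rewrite -lee_fin -psumE//.
  apply: ge_ereal_sup => _ [X [finX _] <-].
  rewrite fsbig_finite//= sumEFin lee_fin; exact: fM (fset_uniq _).
apply: summ_of_bounded; exists M => s us; apply: le_trans (fM s us).
by apply: ler_sum => n _; rewrite ger0_norm.
Qed.

Lemma psum_ge_fin f s : (forall n, 0 <= f n) -> summ f -> uniq s ->
  \sum_(n <- s) f n <= psum f.
Proof.
move=> f0 sf us; rewrite -lee_fin -psumE// -sumEFin.
apply: ereal_sup_ubound; exists [set` s] => //.
exact/esym/fsbig_seq.
Qed.

Lemma psum_ge0 f : (forall n, 0 <= f n) -> 0 <= psum f.
Proof. by move=> f0; apply: fine_ge0; apply: esum_ge0 => n _; rewrite lee_fin. Qed.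

Lemma psumD f g : (forall n, 0 <= f n) -> (forall n, 0 <= g n) ->
  summ f -> summ g -> psum (fun n => f n + g n) = psum f + psum g.
Proof.
move=> f0 g0 sf sg; apply: EFin_inj; rewrite EFinD -!psumE//.
- by rewrite -esumD// => n _; rewrite lee_fin.
- by move=> n; exact: addr_ge0.
- exact: summD.
Qed.

Lemma summ_max f : summ f -> summ (fun n => Num.max (f n) 0).
Proof.
apply: summ_le => n; case: (leP (f n) 0); rewrite ?normr0 ?normr_ge0//.
Qed.

(** All linearity properties reduce to this: the positive and negative parts
    may be replaced by any two nonnegative summable functions with the same
    difference, and those can be added up termwise. *)
Lemma tsum_sub f g h : (forall n, 0 <= g n) -> (forall n, 0 <= h n) ->
  summ g -> summ h -> (forall n, f n = g n - h n) ->
  tsum f = psum g - psum h.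
Proof.
move=> g0 h0 sg sh fE.
have sf : summ f.
  have -> : f = (fun n => g n + - h n) by apply/funext => n; rewrite fE.
  exact: summD (summN sh).
have m0 k : forall n : T, 0 <= Num.max (k n : R) 0.
  by move=> n; rewrite le_max lexx orbT.
have e : psum (fun n => Num.max (f n) 0) + psum h =
    psum (fun n => Num.max (- f n) 0) + psum g.
  rewrite -!psumD//; try exact: summ_max; try exact/summ_max/summN.
  - congr psum; apply/funext => n; rewrite fE.
    by case: (leP (g n - h n) 0) => ?; case: leP => ?; lra.
  - exact: (m0 (fun n => - f n)).
rewrite /tsum; lra.
Qed.

Lemma tsum_psum f : (forall n, 0 <= f n) -> summ f -> tsum f = psum f.
Proof.
move=> f0 sf; have s0 : summ (fun=> 0 : R).
  by apply: summ_le sf => n; rewrite normr0.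
rewrite (tsum_sub (g := f) (h := fun=> 0))//; last by move=> n; rewrite subr0.
suff -> : psum (fun=> 0) = 0 by rewrite subr0.
by rewrite /psum esum1.
Qed.

Lemma eq_tsum f g : (forall n, f n = g n) -> tsum f = tsum g.
Proof. by move=> fg; congr tsum; apply/funext. Qed.

Lemma tsumN f : tsum (fun n => - f n) = - tsum f.
Proof.
rewrite /tsum opprB; congr (psum _ - psum _).
by apply/funext => n; rewrite opprK.
Qed.

Lemma tsumD f g : summ f -> summ g ->
  tsum (fun n => f n + g n) = tsum f + tsum g.
Proof.
move=> sf sg; pose p (k : T -> R) n := Num.max (k n) 0.
pose q (k : T -> R) n := Num.max (- k n) 0.
have p0 k n : 0 <= p k n by rewrite le_max lexx orbT.
have q0 k n : 0 <= q k n by rewrite le_max lexx orbT.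
have sp k : summ k -> summ (p k) by exact: summ_max.
have sq k : summ k -> summ (q k) by move=> ?; exact/summ_max/summN.
rewrite (tsum_sub (g := fun n => p f n + p g n) (h := fun n => q f n + q g n)).
- rewrite !psumD//; try exact: sp; try exact: sq.
  by rewrite /tsum -/(p f) -/(p g) -/(q f) -/(q g); lra.
- by move=> n; exact: addr_ge0.
- by move=> n; exact: addr_ge0.
- by apply: summD; exact: sp.
- by apply: summD; exact: sq.
- by move=> n; rewrite /p /q; case: (leP (f n) 0) => ?; case: (leP (g n) 0) => ?;
    case: leP => ?; case: leP => ?; lra.
Qed.

Lemma tsum_ge0 f : (forall n, 0 <= f n) -> summ f -> 0 <= tsum f.
Proof. by move=> f0 sf; rewrite tsum_psum//; exact: psum_ge0. Qed.

Lemma le_tsum f g : summ f -> summ g -> (forall n, f n <= g n) ->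
  tsum f <= tsum g.
Proof.
move=> sf sg fg; rewrite -subr_ge0 -tsumN -tsumD//; last exact: summN.
apply: tsum_ge0; first by move=> n; rewrite subr_ge0.
exact: summD (summN sf).
Qed.

Lemma psumZ a f : 0 <= a -> (forall n, 0 <= f n) -> summ f ->
  psum (fun n => a * f n) <= a * psum f.
Proof.
move=> a0 f0 sf; apply: psum_le_ub; first by move=> n; exact: mulr_ge0.
move=> s us; rewrite -mulr_sumr ler_wpM2l//; exact: psum_ge_fin.
Qed.

Lemma summZ a f : summ f -> summ (fun n => a * f n).
Proof.
move=> sf; apply: summ_of_bounded; exists (`|a| * psum (fun n => `|f n|)) => s us.
under eq_bigr do rewrite normrM.
rewrite -mulr_sumr ler_wpM2l//; apply: psum_ge_fin => //.
by apply: summ_le sf => n; rewrite normr_id.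
Qed.

Lemma tsumZ a f : summ f -> tsum (fun n => a * f n) = a * tsum f.
Proof.
move=> sf.
have pos b g : 0 < b -> (forall n, 0 <= g n) -> summ g ->
    psum (fun n => b * g n) = b * psum g.
  move=> b0 g0 sg; apply/eqP; rewrite eq_le psumZ ?(ltW b0)//=.
  rewrite -ler_pdivlMl// -[X in psum X](_ : (fun n => b^-1 * (b * g n)) = g).
    apply: psumZ; rewrite ?invr_ge0 ?(ltW b0)//; last exact: summZ.
    by move=> n; rewrite mulr_ge0 // ltW.
  by apply/funext => n; rewrite mulKf ?gt_eqF.
have gen b g : 0 < b -> summ g -> tsum (fun n => b * g n) = b * tsum g.
  move=> b0 sg; rewrite (tsum_sub (g := fun n => b * Num.max (g n) 0)
    (h := fun n => b * Num.max (- g n) 0)).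
  - rewrite !pos//; first by rewrite -mulrBr.
    + by move=> n; rewrite le_max lexx orbT.
    + exact/summ_max/summN.
    + by move=> n; rewrite le_max lexx orbT.
    + exact/summ_max.
  - by move=> n; rewrite mulr_ge0 ?(ltW b0)// le_max lexx orbT.
  - by move=> n; rewrite mulr_ge0 ?(ltW b0)// le_max lexx orbT.
  - exact/summZ/summ_max.
  - exact/summZ/summ_max/summN.
  - move=> n; rewrite -mulrBr; congr (_ * _).
    by case: (leP (g n) 0) => ?; case: (leP (- g n) 0) => ?; lra.
have [a0|a0|->] := ltgtP a 0; last 1 first.
- rewrite mul0r (@eq_tsum _ (fun=> 0)); last by move=> n; rewrite mul0r.
  by rewrite /tsum oppr0 subrr.
- rewrite -[LHS]opprK -tsumN (@eq_tsum _ (fun n => (- a) * f n)).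
    by rewrite gen ?oppr_gt0//; lra.
  by move=> n; rewrite mulNr.
- exact: gen.
Qed.

Lemma tsum_big (I : Type) (r : seq I) (F : I -> T -> R) :
  (forall i, summ (F i)) ->
  summ (fun n => \sum_(i <- r) F i n) /\
  tsum (fun n => \sum_(i <- r) F i n) = \sum_(i <- r) tsum (F i).
Proof.
move=> sF; elim: r => [|i r [IH1 IH2]].
  have s0 : summ (fun n => \sum_(i <- [::]) F i n).
    by apply: summ_of_bounded; exists 0 => s _; rewrite big1// => n _; rewrite big_nil normr0.
  split=> //; rewrite big_nil tsum_psum//; last by move=> n; rewrite big_nil.
  by rewrite /psum esum1// => n _; rewrite big_nil.
have e : (fun n => \sum_(j <- i :: r) F j n) =
    (fun n => F i n + \sum_(j <- r) F j n).
  by apply/funext => n; rewrite big_cons.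
by rewrite e big_cons -IH2 tsumD//; split => //; exact: summD.
Qed.

Lemma psum_bij f (e : T -> T) : bijective e -> psum (f \o e) = psum f.
Proof.
move=> be; rewrite /psum; congr fine.
by rewrite [RHS](@reindex_esum _ _ _ setT setT e)// setTT_bijective.
Qed.

Lemma summ_bij f (e : T -> T) : bijective e -> summ f -> summ (f \o e).
Proof.
move=> be; rewrite /summ/summable.
by rewrite [X in (X < _)%E -> _](@reindex_esum _ _ _ setT setT e)// setTT_bijective.
Qed.

Lemma tsum_bij f (e : T -> T) : bijective e -> tsum (f \o e) = tsum f.
Proof.
by move=> be; rewrite /tsum -(psum_bij (fun n => Num.max (f n) 0) be)
  -(psum_bij (fun n => Num.max (- f n) 0) be).
Qed.

Lemma sum_le_support g s s' : (forall n, 0 <= g n) -> uniq s -> uniq s' ->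
  (forall n, n \notin s -> g n = 0) ->
  \sum_(n <- s') g n <= \sum_(n <- s) g n.
Proof.
move=> g0 us us' gs.
rewrite (bigID (fun n => n \in s))/= [X in _ + X]big1 ?addr0//.
rewrite -big_filter (perm_big [seq n <- s | n \in s'])/=; last first.
  by apply: uniq_perm; rewrite ?filter_uniq// => n; rewrite !mem_filter andbC.
rewrite big_filter [leRHS](bigID (fun n => n \in s'))/=.
by rewrite lerDl sumr_ge0.
Qed.

Lemma psum_split s f : (forall n, 0 <= f n) -> summ f -> uniq s ->
  psum f = \sum_(n <- s) f n + psum (fun n => if n \in s then 0 else f n).
Proof.
move=> f0 sf us.
pose g n := if n \in s then f n else 0; pose h n := if n \in s then 0 else f n.
have g0 n : 0 <= g n by rewrite /g; case: ifP.
have h0 n : 0 <= h n by rewrite /h; case: ifP.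
have sg : summ g by apply: summ_le sf => n; rewrite /g; case: ifP; rewrite ?normr0.
have sh : summ h by apply: summ_le sf => n; rewrite /h; case: ifP; rewrite ?normr0.
have -> : f = (fun n => g n + h n).
  by apply/funext => n; rewrite /g /h; case: ifP; rewrite ?addr0 ?add0r.
rewrite psumD//; congr (_ + _); last first.
  by congr psum; apply/funext => n; rewrite /g /h; case: ifP; rewrite ?add0r.
have -> : \sum_(n <- s) (g n + h n) = \sum_(n <- s) g n.
  by apply: eq_big_seq => n ns; rewrite /h ns addr0.
apply/eqP; rewrite eq_le psum_ge_fin// andbT.
apply: psum_le_ub => // s' us'; apply: sum_le_support => // n /negbTE ns.
by rewrite /g ns.
Qed.

Lemma tsum_split s f : summ f -> uniq s ->
  tsum f = \sum_(n <- s) f n + tsum (fun n => if n \in s then 0 else f n).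
Proof.
move=> sf us.
rewrite /tsum (psum_split (s := s))//;
  [|by move=> n; rewrite le_max lexx orbT|exact: summ_max].
rewrite [X in _ - X = _](psum_split (s := s))//;
  [|by move=> n; rewrite le_max lexx orbT|exact/summ_max/summN].
have -> : (fun n => Num.max (if n \in s then 0 else f n) 0) =
  (fun n => if n \in s then 0 else Num.max (f n) 0).
  by apply/funext => n; case: ifP => //; rewrite maxxx.
have -> : (fun n => Num.max (- (if n \in s then 0 else f n)) 0) =
  (fun n => if n \in s then 0 else Num.max (- f n) 0).
  by apply/funext => n; case: ifP => //; rewrite oppr0 maxxx.
have -> : \sum_(n <- s) f n = \sum_(n <- s) Num.max (f n) 0 - \sum_(n <- s) Num.max (- f n) 0.
  rewrite -sumrB; apply: eq_bigr => n _; case: (leP (f n) 0) => ?; case: (leP (- f n) 0) => ?; lra.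
lra.
Qed.

Lemma tsum_fin s f : uniq s -> (forall n, n \notin s -> f n = 0) ->
  summ f /\ tsum f = \sum_(n <- s) f n.
Proof.
move=> us f0.
have sf : summ f.
  apply: summ_of_bounded; exists (\sum_(n <- s) `|f n|) => s' us'.
  by apply: sum_le_support => // n /f0 ->; rewrite normr0.
split=> //; rewrite (tsum_split sf us) [X in _ + X](_ : _ = 0) ?addr0//.
have -> : (fun n => if n \in s then 0 else f n) = (fun=> 0).
  by apply/funext => n; case: ifPn => // /f0.
by rewrite /tsum oppr0 subrr.
Qed.

Lemma tail_small f e : (forall n, 0 <= f n) -> summ f -> 0 < e ->
  exists2 s, uniq s & psum (fun n => if n \in s then 0 else f n) < e.
Proof.
move=> f0 sf e0.
have : ((psum f - e)%:E < \esum_(n in [set: T]) (f n)%:E)%E.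
  by rewrite psumE// lte_fin ltrBlDr ltrDl.
move=> /ereal_sup_gt[_ [X [finX _] <-]].
rewrite fsbig_finite//= sumEFin lte_fin => lt.
exists (fset_set X) => //.
have := psum_split f0 sf (fset_uniq (fset_set X)); lra.
Qed.

End Sums.

(** * The Hilbert space of square summable functions *)

Section SquareSummable.
Variables (R : realType) (T : choiceType).

Definition sqsumm : {pred T -> R} := fun u => `[< summ (fun n => u n ^+ 2) >].

Lemma sqsummP u : reflect (summ (fun n => u n ^+ 2)) (u \in sqsumm).
Proof. exact: asboolP. Qed.

Lemma sqsumm_le (u v : T -> R) : (forall n, `|u n| <= `|v n|) ->
  v \in sqsumm -> u \in sqsumm.
Proof.
move=> uv /sqsummP sv; apply/sqsummP; apply: summ_le sv => n.
by rewrite !normrX lerXn2r ?nnegrE.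
Qed.

Lemma sqsummZ a (u : T -> R) : u \in sqsumm -> (fun n => a * u n) \in sqsumm.
Proof.
move=> /sqsummP su; apply/sqsummP; have := summZ (a ^+ 2) su.
by congr summ; apply/funext => n; rewrite exprMn.
Qed.

Lemma summM (u v : T -> R) : u \in sqsumm -> v \in sqsumm ->
  summ (fun n => u n * v n).
Proof.
move=> /sqsummP su /sqsummP sv; apply: summ_le (summD su sv) => n.
rewrite normrM [leRHS]ger0_norm ?addr_ge0 ?sqr_ge0//.
rewrite -[u n ^+ 2]real_normK ?num_real// -[v n ^+ 2]real_normK ?num_real//.
have := sqr_ge0 (`|u n| - `|v n|); have := mulr_ge0 (normr_ge0 (u n)) (normr_ge0 (v n)); nra.
Qed.

Lemma sqsumm_submod : submod_closed sqsumm.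
Proof.
split=> [|a u v su sv].
  by apply/sqsummP; apply: summ_of_bounded; exists 0 => s _; rewrite big1// => n _;
    rewrite expr0n normr0.
apply/sqsummP; move: (sqsummZ a su) sv => /[dup] sau /sqsummP sau2 /[dup] sv /sqsummP sv2.
have := summD (summD sau2 sv2) (summZ 2 (summM sau sv)).
by congr summ; apply/funext => n /=; rewrite /= -[(a *: u + v) n]/(a * u n + v n); ring.
Qed.

HB.instance Definition _ := GRing.isSubmodClosed.Build R (T -> R) sqsumm
  sqsumm_submod.

Record l2 := L2 { l2_val :> T -> R; _ : l2_val \in sqsumm }.

HB.instance Definition _ := [isSub for l2_val].
HB.instance Definition _ := [Choice of l2 by <:].
HB.instance Definition _ := [SubChoice_isSubLmodule of l2 by <:].

Implicit Types (x y z : l2).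

Lemma l2P x : l2_val x \in sqsumm. Proof. exact: valP. Qed.

Lemma l2_ext x y : (forall n, x n = y n) -> x = y.
Proof. by move=> xy; apply/val_inj/funext. Qed.

Lemma l2D x y n : (x + y) n = x n + y n. Proof. by []. Qed.
Lemma l2N x n : (- x) n = - x n. Proof. by []. Qed.
Lemma l2B x y n : (x - y) n = x n - y n. Proof. by []. Qed.
Lemma l2Z a x n : (a *: x) n = a * x n. Proof. by []. Qed.
Lemma l20 n : (0 : l2) n = 0. Proof. by []. Qed.
Definition l2E := (l2B, l2D, l2N, l2Z, l20).

(** Total, with value 0 on functions that are not square summable, so that
    operators can be defined without carrying proofs. *)
Definition toL2 (u : T -> R) : l2 := insubd (0 : l2) u.

Lemma toL2E u : u \in sqsumm -> l2_val (toL2 u) = u.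
Proof. by move=> su; rewrite /toL2 -[l2_val _]/(val _) insubdK. Qed.

Definition dot x y : R := tsum (fun n => x n * y n).

Lemma dotC x y : dot x y = dot y x.
Proof. by apply: eq_tsum => n; rewrite mulrC. Qed.

Lemma dotDl x y z : dot (x + y) z = dot x z + dot y z.
Proof.
rewrite /dot -tsumD; try exact: summM (l2P _) (l2P _).
by apply: eq_tsum => n; rewrite l2D mulrDl.
Qed.

Lemma dotZl a x y : dot (a *: x) y = a * dot x y.
Proof.
rewrite /dot -tsumZ; last exact: summM (l2P _) (l2P _).
by apply: eq_tsum => n; rewrite l2Z mulrA.
Qed.

Lemma dotNl x y : dot (- x) y = - dot x y.
Proof. by rewrite -scaleN1r dotZl mulN1r. Qed.
Lemma dotBl x y z : dot (x - y) z = dot x z - dot y z.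
Proof. by rewrite dotDl dotNl. Qed.
Lemma dotDr x y z : dot x (y + z) = dot x y + dot x z.
Proof. by rewrite dotC dotDl !(dotC x). Qed.
Lemma dotZr a x y : dot x (a *: y) = a * dot x y.
Proof. by rewrite dotC dotZl dotC. Qed.
Lemma dotNr x y : dot x (- y) = - dot x y.
Proof. by rewrite dotC dotNl dotC. Qed.
Lemma dotBr x y z : dot x (y - z) = dot x y - dot x z.
Proof. by rewrite dotDr dotNr. Qed.
Lemma dot0l y : dot 0 y = 0.
Proof. by rewrite -(scale0r (0 : l2)) dotZl mul0r. Qed.
Lemma dot0r y : dot y 0 = 0. Proof. by rewrite dotC dot0l. Qed.

Definition dotE := (dotDl, dotDr, dotBl, dotBr, dotNl, dotNr, dotZl, dotZr,
  dot0l, dot0r).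

Lemma dot_ge0 x : 0 <= dot x x.
Proof.
by apply: tsum_ge0 => [n|]; [rewrite -expr2 sqr_ge0|exact: summM (l2P _) (l2P _)].
Qed.

Lemma coord_le x n : x n ^+ 2 <= dot x x.
Proof.
have sx : summ (fun n => x n * x n) by exact: summM (l2P _) (l2P _).
rewrite /dot tsum_psum//; last by move=> m; rewrite -expr2 sqr_ge0.
have := @psum_ge_fin _ _ (fun n => x n * x n) [:: n].
by rewrite big_seq1 -expr2; apply => // m; rewrite -expr2 sqr_ge0.
Qed.

Lemma dot_eq0 x : dot x x = 0 -> x = 0.
Proof.
move=> x0; apply: l2_ext => n; apply/eqP; rewrite l20 -sqrf_eq0 eq_le sqr_ge0.
by rewrite andbT -x0 coord_le.
Qed.

Lemma dot_ext x y : (forall h, dot x h = dot y h) -> x = y.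
Proof.
by move=> xy; apply/eqP; rewrite -subr_eq0; apply/eqP/dot_eq0;
  rewrite dotBl xy subrr.
Qed.

Lemma CauchySchwarz x y : dot x y ^+ 2 <= dot x x * dot y y.
Proof.
have [y0|y0] := eqVneq (dot y y) 0.
  by rewrite (dot_eq0 y0) !dot0r expr0n mulr0.
have yp : 0 < dot y y by rewrite lt_neqAle eq_sym y0 dot_ge0.
have := dot_ge0 (dot y y *: x - dot x y *: y).
rewrite !dotE (dotC y x).
set a := dot x x; set b := dot x y; set c := dot y y => h.
have : 0 <= c * (a * c - b ^+ 2) by move: h; rewrite -/c; nra.
by rewrite pmulr_rge0// subr_ge0.
Qed.

Lemma dotD_le x y : dot (x + y) (x + y) <= 2 * dot x x + 2 * dot y y.
Proof. have := dot_ge0 (x - y); rewrite !dotE (dotC y x); lra. Qed.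

Lemma fin_sqsumm s (u : T -> R) : uniq s -> (forall n, n \notin s -> u n = 0) ->
  u \in sqsumm.
Proof.
move=> us u0; apply/sqsummP.
by apply: (tsum_fin (s := s) us _).1 => n /u0 ->; rewrite expr0n.
Qed.

Lemma dot_fin s x y : uniq s -> (forall n, n \notin s -> y n = 0) ->
  dot x y = \sum_(n <- s) x n * y n.
Proof.
by move=> us y0; apply: (tsum_fin us _).2 => n /y0 ->; rewrite mulr0.
Qed.

Definition delta_l2 (n : T) : l2 := toL2 (fun m => (m == n)%:R).

Lemma delta_l2E n m : delta_l2 n m = (m == n)%:R.
Proof.
rewrite /delta_l2 toL2E//; apply: (fin_sqsumm (s := [:: n])) => // k.
by rewrite inE => /negbTE ->.
Qed.

Lemma dot_delta x n : dot x (delta_l2 n) = x n.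
Proof.
rewrite (dot_fin (s := [:: n]))//.
  by rewrite big_seq1 delta_l2E eqxx mulr1.
by move=> k; rewrite inE delta_l2E => /negbTE ->.
Qed.

End SquareSummable.

Arguments dot {R T}.

(** * Weak convergence *)

Section RealFilters.
Variables (R : realType) (F : set_system nat).
Context {FF : ProperFilter F}.
Implicit Types (f g : nat -> R) (l M e : R).

Lemma cvg_eq f g l : (forall k, f k = g k) -> f k @[k --> F] --> l ->
  g k @[k --> F] --> l.
Proof. by move=> fg; have -> : f = g by apply/funext. Qed.

Lemma cvg0_le f g : (forall k, `|f k| <= g k) -> g k @[k --> F] --> (0 : R) ->
  f k @[k --> F] --> (0 : R).
Proof.
move=> fg g0; apply/norm_cvg0P.
apply: (@squeeze_cvgr _ _ _ R (fun=> 0) g (fun k => `|f k|)) => //.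
  by near=> k; rewrite normr_ge0 fg.
exact: cvg_cst.
Unshelve. all: end_near. Qed.

Lemma cvg0_lt f e : f k @[k --> F] --> (0 : R) -> 0 < e ->
  \forall k \near F, `|f k| < e.
Proof. by move=> /cvgr0Pnorm_lt f0 e0; exact: f0. Qed.

Lemma cvg0_sqr f : f k ^+ 2 @[k --> F] --> (0 : R) -> f k @[k --> F] --> (0 : R).
Proof.
move=> f0; apply/cvgr0Pnorm_lt => e e0.
have := cvg0_lt f0 (exprn_gt0 2 e0); apply: filterS => k.
by rewrite normrX ltr_pXn2r// nnegrE ?normr_ge0 ?(ltW e0).
Qed.

Lemma cvg_bigsum (I : Type) (r : seq I) (f : nat -> I -> R)
  (l : I -> R) :
  (forall i, f k i @[k --> F] --> l i) ->
  \sum_(i <- r) f k i @[k --> F] --> \sum_(i <- r) l i.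
Proof.
move=> fl; apply: (@cvg_big R I +%R 0 xpredT _ nat F r (fun i k => f k i) l) => //.
exact: add_continuous.
Qed.

Lemma cvg_bigsum0 (I : Type) (r : seq I) (f : nat -> I -> R) :
  (forall i, f k i @[k --> F] --> (0 : R)) ->
  \sum_(i <- r) f k i @[k --> F] --> (0 : R).
Proof.
move=> f0; have z : \sum_(i <- r) (0 : R) = 0 by rewrite big1.
have := @cvg_bigsum I r f (fun=> 0) f0; rewrite z; exact.
Qed.

Lemma limit_le f l M : f k @[k --> F] --> l -> (forall k, f k <= M) -> l <= M.
Proof.
move=> fl fM; apply: (ler_cvg_to fl (cvg_cst M)); by near=> k; exact: fM.
Unshelve. all: end_near. Qed.

Lemma limit_ge f l M : f k @[k --> F] --> l -> (forall k, M <= f k) -> M <= l.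
Proof.
move=> fl fM; apply: (ler_cvg_to (cvg_cst M) fl); by near=> k; exact: fM.
Unshelve. all: end_near. Qed.

End RealFilters.

(** Ultrafilters replace the extraction of subsequences: along one of them every
    bounded sequence converges, hence all coordinates of a bounded sequence
    converge simultaneously. *)
Lemma ultra_bounded_cvg (R : realType) (U : set_system nat) (f : nat -> R) (B : R) :
  UltraFilter U -> (forall k, `|f k| <= B) -> exists l : R, f k @[k --> U] --> l.
Proof.
move=> UU fB; have cB := @segment_compact R (- B) B.
have [|p [_ clp]] := cB (f @ U) _.
  rewrite /fmap/=; apply: (@filterE _ U) => k /=; rewrite in_itv/=.
  by have := fB k; rewrite ler_norml.
exists p => A Ap; have [//|nA] := in_ultra_setVsetC (f @^-1` A) UU.
by have [y [/= nAy Ay]] := clp (~` A) A nA Ap; have := nAy Ay.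
Qed.

Section WeakConvergence.
Variables (R : realType) (T : choiceType).
Local Notation H := (l2 R T).
Implicit Types (x y z h : H) (r : nat -> H) (A B : H -> H) (V : T -> R).

Definition wcvg (F : set_system nat) r z :=
  forall h, dot (r k) h @[k --> F] --> dot z h.

Definition bounded_seq r := exists M, forall k, dot (r k) (r k) <= M.

Lemma bounded_seqB r z : bounded_seq r -> bounded_seq (fun k => r k - z).
Proof.
move=> [M rM]; exists (2 * M + 2 * dot z z) => k.
apply: le_trans (dotD_le (r k) (- z)) _; rewrite !dotE opprK.
by have := rM k; lra.
Qed.

Lemma wcvg_coord F r z n : wcvg F r z -> r k n @[k --> F] --> z n.
Proof.
by move=> /(_ (delta_l2 R n)); rewrite dot_delta; under eq_fun do rewrite dot_delta.
Qed.

Lemma strong_wcvg F (FF : ProperFilter F) r z :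
  dot (r k - z) (r k - z) @[k --> F] --> (0 : R) -> wcvg F r z.
Proof.
move=> rz h; apply/subr_cvg0; apply: (cvg_eq (f := fun k => dot (r k - z) h)).
  by move=> k; rewrite dotBl.
apply: cvg0_sqr.
apply: (@cvg0_le _ _ _ _ (fun k => dot (r k - z) (r k - z) * dot h h)).
  by move=> k; rewrite ger0_norm ?sqr_ge0// CauchySchwarz.
by rewrite -[X in _ --> X](mul0r (dot h h)); apply: cvgM => //; exact: cvg_cst.
Qed.

(** Up to an error which is small by the Cauchy-Schwarz inequality, the test
    vector may be cut off to a finite set, and there coordinates suffice. *)
Lemma pointwise_wcvg F (FF : ProperFilter F) r z : bounded_seq r ->
  (forall n, r k n @[k --> F] --> z n) -> wcvg F r z.
Proof.
move=> /(@bounded_seqB _ z) [M wM] rz h; apply/subr_cvg0.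
apply: (cvg_eq (f := fun k => dot (r k - z) h)); first by move=> k; rewrite dotBl.
have M0 : 0 <= M by apply: le_trans (wM 0%N); exact: dot_ge0.
apply/cvgr0Pnorm_lt => e e0.
have sh : summ (fun n => h n ^+ 2) by apply/sqsummP/l2P.
have e4 : 0 < e ^+ 2 / (4 * (M + 1)).
  by rewrite divr_gt0 ?exprn_gt0// mulr_gt0//; lra.
have [s us hs] := tail_small (fun n => sqr_ge0 (h n)) sh e4.
pose h1 := toL2 (fun n => if n \in s then h n else 0).
have h1E n : h1 n = if n \in s then h n else 0.
  rewrite /h1 toL2E//; apply: sqsumm_le (l2P h) => m.
  by case: ifP; rewrite ?normr0.
pose h2 := h - h1.
have h2E n : h2 n = if n \in s then 0 else h n.
  by rewrite /h2 l2E h1E; case: ifP; rewrite ?subrr ?subr0.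
have h2small : dot h2 h2 < e ^+ 2 / (4 * (M + 1)).
  apply: le_lt_trans hs; rewrite /dot tsum_psum.
  - rewrite le_eqVlt; apply/orP; left; apply/eqP; congr psum; apply/funext => n.
    by rewrite h2E; case: ifP; rewrite ?mul0r -?expr2.
  - by move=> n; rewrite -expr2 sqr_ge0.
  - exact: summM (l2P _) (l2P _).
have c1 : dot (r k - z) h1 @[k --> F] --> (0 : R).
  apply: (cvg_eq (f := fun k => \sum_(n <- s) (r k n - z n) * h1 n)).
    move=> k; rewrite (dot_fin (s := s))// => n /negbTE ns.
    by rewrite h1E ns.
  apply: (@cvg_bigsum0 R F _ _ s (fun k n => (r k n - z n) * h1 n)) => n.
  rewrite -[X in _ --> X](mul0r (h1 n)).
  by apply: cvgM; [exact/subr_cvg0|exact: cvg_cst].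
have e2 : 0 < e / 2 by rewrite divr_gt0.
apply: filterS (cvg0_lt c1 e2) => k k1.
have -> : dot (r k - z) h = dot (r k - z) h1 + dot (r k - z) h2.
  by rewrite /h2 dotBr; lra.
apply: le_lt_trans (ler_normD _ _) _.
suff : `|dot (r k - z) h2| <= e / 2 by lra.
rewrite -(@ler_pXn2r _ 2)// ?nnegrE ?(ltW e2)// -normrX ger0_norm ?sqr_ge0//.
apply: le_trans (CauchySchwarz _ _) _.
apply: (@le_trans _ _ (M * (e ^+ 2 / (4 * (M + 1))))).
  by apply: ler_pM; [exact: dot_ge0|exact: dot_ge0|exact: wM|exact: ltW].
rewrite exprMn mulrA ler_pdivrMr; last by lra.
have := sqr_ge0 e; nra.
Qed.

(** The coordinatewise limit is square summable because every finite partial sum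
    of its squares is a limit of numbers at most [M]. *)
Lemma ultra_wcvg (U : set_system nat) r : UltraFilter U -> bounded_seq r ->
  exists z, wcvg U r z.
Proof.
move=> UU rb; have [M rM] := rb.
have M0 : 0 <= M by apply: le_trans (rM 0%N); exact: dot_ge0.
have lim n : exists l : R, r k n @[k --> U] --> l.
  apply: (@ultra_bounded_cvg _ _ _ (M + 1)) => // k.
  have := le_trans (coord_le (r k) n) (rM k); rewrite -[_ ^+ 2]real_normK ?num_real//.
  have := normr_ge0 (r k n); nra.
pose u n := projT1 (cid (lim n)).
have uP n : r k n @[k --> U] --> u n by rewrite /u; case: cid.
have su : u \in @sqsumm R T.
  apply/sqsummP; apply: summ_of_bounded; exists M => s us.
  have c : \sum_(n <- s) `|r k n ^+ 2| @[k --> U] --> \sum_(n <- s) `|u n ^+ 2|.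
    by apply: cvg_bigsum => n; apply: cvg_norm; rewrite expr2; exact: cvgM.
  apply: (limit_le c) => k; apply: le_trans (rM k).
  rewrite /dot tsum_psum; last exact: summM (l2P _) (l2P _).
    under eq_bigr do rewrite ger0_norm ?sqr_ge0// expr2.
    apply: psum_ge_fin => //; last exact: summM (l2P _) (l2P _).
    by move=> n; rewrite -expr2 sqr_ge0.
  by move=> n; rewrite -expr2 sqr_ge0.
exists (toL2 u); apply: pointwise_wcvg => // n; by rewrite toL2E.
Qed.

Definition vanishing V :=
  forall e : R, 0 < e -> exists2 s : seq T, uniq s & forall n, n \notin s -> `|V n| < e.

Definition mulL2 V x : H := toL2 (fun n => V n * x n).

Lemma vanishing_bounded V : vanishing V -> exists C : R, forall n, `|V n| <= C.
Proof.
move=> /(_ 1 ltr01)[s us sV]; exists (1 + \sum_(n <- s) `|V n|) => n.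
have s0 : 0 <= \sum_(n <- s) `|V n| by apply: sumr_ge0.
have [ns|/sV] := boolP (n \in s); last lra.
rewrite (perm_big _ (perm_to_rem ns)) big_cons/=.
have : 0 <= \sum_(j <- rem n s) `|V j| by apply: sumr_ge0.
lra.
Qed.

Lemma mulL2E V x n : vanishing V -> mulL2 V x n = V n * x n.
Proof.
move=> /vanishing_bounded[C VC]; rewrite /mulL2 toL2E//.
apply: sqsumm_le (sqsummZ C (l2P x)) => m.
rewrite !normrM ler_wpM2r// (le_trans (VC m))// ler_norm//.
Qed.

(** Multiplication by a function vanishing at infinity is a compact operator: off
    a finite set the multiplier is small, on it weak convergence is strong. *)
Lemma mulL2_compact V (F : set_system nat) (FF : ProperFilter F) r :
  vanishing V -> bounded_seq r -> wcvg F r 0 ->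
  dot (mulL2 V (r k)) (mulL2 V (r k)) @[k --> F] --> (0 : R).
Proof.
move=> vV [M rM] r0.
have M0 : 0 <= M by apply: le_trans (rM 0%N); exact: dot_ge0.
apply/cvgr0Pnorm_lt => e e0.
have e1 : 0 < Num.min 1 (e / (2 * (M + 1))).
  by rewrite lt_min ltr01 divr_gt0// mulr_gt0//; lra.
have [s us sV] := vV _ e1.
have c1 : \sum_(n <- s) (V n * r k n) ^+ 2 @[k --> F] --> (0 : R).
  apply: (@cvg_bigsum0 R F _ _ s (fun k n => (V n * r k n) ^+ 2)) => n.
  rewrite -[X in _ --> X](mul0r (0 : R)).
  have c : V n * r k n @[k --> F] --> (0 : R).
    rewrite -[X in _ --> X](mulr0 (V n)); apply: cvgM; first exact: cvg_cst.
    exact: wcvg_coord r0.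
  exact: cvgM.
have e2 : 0 < e / 2 by rewrite divr_gt0.
apply: filterS (cvg0_lt c1 e2) => k k1.
rewrite ger0_norm ?dot_ge0//.
have sVr : summ (fun n => mulL2 V (r k) n * mulL2 V (r k) n) by exact: summM (l2P _) (l2P _).
have sr : summ (fun n => r k n * r k n) by exact: summM (l2P _) (l2P _).
rewrite /dot (tsum_split sVr us).
have -> : \sum_(n <- s) mulL2 V (r k) n * mulL2 V (r k) n =
    \sum_(n <- s) (V n * r k n) ^+ 2.
  by apply: eq_bigr => n _; rewrite !mulL2E.
move: k1; rewrite ger0_norm ?sumr_ge0// => [k1|n _]; last exact: sqr_ge0.
suff : tsum (fun n => if n \in s then 0 else mulL2 V (r k) n * mulL2 V (r k) n)
    <= e / (2 * (M + 1)) * M.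
  have : e / (2 * (M + 1)) * M <= e / 2.
    rewrite mulrAC ler_pdivrMr; last by lra.
    nra.
  lra.
apply: le_trans (_ : tsum (fun n => e / (2 * (M + 1)) * (r k n * r k n)) <= _).
  apply: le_tsum.
  - by apply: summ_le sVr => n; case: ifP; rewrite ?normr0.
  - exact: summZ.
  - move=> n; have rr : 0 <= r k n * r k n by rewrite -expr2 sqr_ge0.
    case: ifPn => [_|/sV].
      by rewrite mulr_ge0// divr_ge0 ?(ltW e0)//; lra.
    rewrite lt_min => /andP[V1 V2]; rewrite mulL2E// mulrACA ler_wpM2r//.
    rewrite -expr2 -real_normK ?num_real// expr2.
    have v0 := normr_ge0 (V n); apply: le_trans (ltW V2); nra.
rewrite tsumZ// ler_wpM2l//; last exact: rM.
by rewrite divr_ge0 ?(ltW e0)//; lra.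
Qed.

End WeakConvergence.

(** * Symmetric operators *)

Section Operators.
Variables (R : realType) (T : choiceType).
Local Notation H := (l2 R T).
Implicit Types (x y z : H) (r : nat -> H) (A B : H -> H).

Definition symmetric_op A := forall x y, dot (A x) y = dot x (A y).

Definition psd_op A := forall x, 0 <= dot (A x) x.

(** A symmetric operator is automatically linear, since vectors are determined
    by their inner products. *)
Lemma symD A x y : symmetric_op A -> A (x + y) = A x + A y.
Proof. by move=> sA; apply: dot_ext => h; rewrite sA !dotE -!sA. Qed.

Lemma symZ A a x : symmetric_op A -> A (a *: x) = a *: A x.
Proof. by move=> sA; apply: dot_ext => h; rewrite sA !dotE -!sA. Qed.

Lemma symB A x y : symmetric_op A -> A (x - y) = A x - A y.
Proof. by move=> sA; apply: dot_ext => h; rewrite sA !dotE -!sA. Qed.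

Lemma sym0 A : symmetric_op A -> A 0 = 0.
Proof. by move=> sA; have := symZ 0 0 sA; rewrite !scale0r. Qed.

Lemma sym_quadD A x y (t : R) : symmetric_op A ->
  dot (A (x + t *: y)) (x + t *: y) =
  dot (A x) x + 2 * t * dot (A x) y + t ^+ 2 * dot (A y) y.
Proof.
by move=> sA; rewrite symD// symZ// !dotE (sA y x) (dotC y (A x)); ring.
Qed.

Lemma sym_wcvg A (F : set_system nat) r z : symmetric_op A ->
  wcvg F r z -> wcvg F (fun k => A (r k)) (A z).
Proof. by move=> sA rz h; rewrite sA; under eq_fun do rewrite sA; exact: rz. Qed.

Lemma discriminant_le (a b c : R) : 0 <= c ->
  (forall t, 0 <= a + 2 * t * b + t ^+ 2 * c) -> b ^+ 2 <= a * c.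
Proof.
rewrite le_eqVlt => /orP[/eqP<- q|c0 q].
  rewrite mulr0 leNgt; apply/negP => /lt0r_neq0; rewrite sqrf_eq0 => b0.
  have := q (- (a + 1) / (2 * b)); rewrite mulr0 addr0.
  rewrite [X in a + X](_ : _ = - (a + 1)); first lra.
  by field.
have := q (- b / c); rewrite [X in 0 <= X](_ : _ = (a * c - b ^+ 2) / c).
  by rewrite pmulr_lge0 ?invr_gt0// subr_ge0.
by field; rewrite gt_eqF.
Qed.

Lemma psd_CauchySchwarz A x y : symmetric_op A -> psd_op A ->
  dot (A x) y ^+ 2 <= dot (A x) x * dot (A y) y.
Proof.
move=> sA pA; apply: discriminant_le; first exact: pA.
by move=> t; rewrite -sym_quadD.
Qed.

Lemma psd_ker A x : symmetric_op A -> psd_op A -> dot (A x) x = 0 -> A x = 0.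
Proof.
move=> sA pA x0; apply: dot_eq0; apply/eqP; rewrite -sqrf_eq0 eq_le sqr_ge0 andbT.
by apply: le_trans (psd_CauchySchwarz _ _ sA pA) _; rewrite x0 mul0r.
Qed.

(** Coercivity modulo a perturbation [K] that vanishes along bounded weakly null
    sequences.  The decay of the potentials enters the spectral arguments in
    this form. *)
Definition weakly_coercive A := exists (w : R) (K : H -> R),
  [/\ 0 < w, forall x, w * dot x x <= dot (A x) x + K x
    & forall (U : set_system nat) r, UltraFilter U -> bounded_seq r ->
        wcvg U r 0 -> K (r k) @[k --> U] --> (0 : R)].

Lemma ultra_eventually : exists U : set_system nat,
  UltraFilter U /\ \oo `<=` U.
Proof. by have [U [UU sU]] := ultraFilterLemma eventually_filter; exists U. Qed.

Lemma cvg_finer (U : set_system nat) (V : topologicalType) (f : nat -> V) (l : V) :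
  \oo `<=` U -> f k @[k --> \oo] --> l -> f k @[k --> U] --> l.
Proof. by move=> oU fl A /fl; exact: oU. Qed.

(** A positive operator that is coercive modulo compact either has a kernel or is
    coercive.  Take a normalized sequence [r] with [<A r, r> -> 0], a weak limit
    [z] and [q = r - z].  The values [<A z, z>] and [<A q, q>] are nonnegative
    and add up to 0 in the limit; so [A z = 0], hence [z = 0], and weak
    coercivity forces [q -> 0] in norm, contradicting the normalization. *)
Lemma coercive_of_trivial_kernel A : symmetric_op A -> psd_op A ->
  weakly_coercive A -> (forall z, A z = 0 -> z = 0) ->
  exists2 c : R, 0 < c & forall z, c * dot z z <= dot (A z) z.
Proof.
move=> sA pA [w [K [w0 AK Kc]]] kA; apply: contrapT => nc.
have /choice[r rP] : forall k, exists z, dot z z = 1 /\ dot (A z) z <= harmonic k.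
  move=> k; apply: contrapT => nz; apply: nc; exists (harmonic k); first exact: harmonic_gt0.
  move=> z; have [z0|z0] := eqVneq (dot z z) 0; first by rewrite z0 mulr0 pA.
  have zp : 0 < dot z z by rewrite lt_neqAle eq_sym z0 dot_ge0.
  rewrite leNgt; apply/negP => zk; apply: nz.
  exists ((Num.sqrt (dot z z))^-1 *: z).
  have e : (Num.sqrt (dot z z))^-1 * (Num.sqrt (dot z z))^-1 = (dot z z)^-1.
    by rewrite -invfM -expr2 sqr_sqrtr// dot_ge0.
  split; first by rewrite dotZl dotZr mulrA e mulVf.
  by rewrite symZ// dotZl dotZr mulrA e ler_pdivrMl// mulrC ltW.
have [U [UU oU]] := ultra_eventually.
have rb : bounded_seq r by exists 1 => k; rewrite (rP k).1.
have [z rz] := ultra_wcvg UU rb.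
pose q k := r k - z.
have q0 : wcvg U q 0.
  move=> h; rewrite dot0l; apply: (cvg_eq (f := fun k => dot (r k) h - dot z h)).
    by move=> k; rewrite /q dotBl.
  exact/subr_cvg0/rz.
have qE k : dot (A (r k)) (r k) = dot (A z) z + 2 * dot (A z) (q k) + dot (A (q k)) (q k).
  have -> : r k = z + 1 *: q k by rewrite scale1r /q addrC subrK.
  by rewrite sym_quadD//; ring.
have h0 : harmonic k @[k --> U] --> (0 : R) by apply: (cvg_finer oU); exact: cvg_harmonic.
have Aq0 : dot (A z) (q k) @[k --> U] --> (0 : R).
  rewrite -(dot0l (A z)); under eq_fun do rewrite dotC; exact: q0.
have up : (harmonic k - 2 * dot (A z) (q k)) @[k --> U] --> (0 : R).
  rewrite -[X in _ --> X](_ : 0 - 2 * 0 = 0); last by rewrite mulr0 subr0.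
  by apply: cvgB => //; apply: cvgM => //; exact: cvg_cst.
have zz : dot (A z) z = 0.
  apply/eqP; rewrite eq_le pA andbT; apply: (limit_ge up) => k.
  have := (rP k).2; rewrite qE; have := pA (q k); lra.
have Aqq : dot (A (q k)) (q k) @[k --> U] --> (0 : R).
  apply: cvg0_le up => k; rewrite ger0_norm ?pA//.
  have := (rP k).2; rewrite qE zz; lra.
have qq : dot (q k) (q k) @[k --> U] --> (0 : R).
  apply: (@cvg0_le _ _ _ _ (fun k => w^-1 * (dot (A (q k)) (q k) + K (q k)))).
    by move=> k; rewrite ger0_norm ?dot_ge0// ler_pdivlMl.
  rewrite -[X in _ --> X](_ : w^-1 * (0 + 0) = 0); last by rewrite addr0 mulr0.
  apply: cvgM; first exact: cvg_cst.
  apply: cvgD => //; apply: Kc => //; exact: bounded_seqB.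
have zq : dot (q k) z @[k --> U] --> (0 : R) by rewrite -(dot0l z); exact: q0.
have : (dot z z + 2 * dot (q k) z + dot (q k) (q k)) @[k --> U] --> dot z z + 2 * 0 + 0.
  by apply: cvgD => //; apply: cvgD; [|apply: cvgM => //]; exact: cvg_cst.
rewrite (kA z (psd_ker sA pA zz)) dot0l mulr0 !addr0 => c1.
have : (1 : R) <= 0.
  apply: (limit_ge c1) => k; rewrite -(rP k).1.
  have -> : r k = z + q k by rewrite /q addrC subrK.
  rewrite (kA z (psd_ker sA pA zz)) !dotE; lra.
by rewrite ler10.
Qed.

(** Coercivity of [A] controls [A \o A] because
    [2 w <A x, x> <= |A x|^2 + w^2 |x|^2]. *)
Lemma weakly_coercive_sqr A : symmetric_op A -> weakly_coercive A ->
  weakly_coercive (A \o A).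
Proof.
move=> sA [w [K [w0 AK Kc]]]; exists (w ^+ 2), (fun x => 2 * w * K x).
split=> [|x|U r UU rb r0]; first by rewrite exprn_gt0.
  have := dot_ge0 (A x - w *: x); have := AK x.
  rewrite /= (sA (A x) x) !dotE (dotC x (A x)).
  by have := dot_ge0 x; nra.
rewrite -[X in _ --> X](mulr0 (2 * w)); apply: cvgM; first exact: cvg_cst.
exact: Kc.
Qed.

(** Let [r_k = x - A z_k] be a sequence whose norms tend to the distance of [x]
    to the range.  Near-minimality makes [r_k] almost orthogonal to the range,
    so a weak limit [w] lies in the kernel and is orthogonal to [x]; then
    [|r_k|^2 = <r_k, x> - <r_k, A z_k>] tends to 0. *)
Lemma range_dense A x : symmetric_op A -> (forall z, A z = 0 -> dot x z = 0) ->
  forall e : R, 0 < e -> exists z, dot (A z - x) (A z - x) < e.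
Proof.
move=> sA kA e e0; pose D := [set dot (x - A z) (x - A z) | z in [set: H]].
have D0 : has_lbound D by exists 0 => _ [z _ <-]; exact: dot_ge0.
have Di : has_inf D by split=> //; exists (dot (x - A 0) (x - A 0)); exists 0.
have /choice[z zP] : forall k, exists z, dot (x - A z) (x - A z) < inf D + harmonic k.
  by move=> k; have [_ [z _ <-] ?] := inf_adherent (@harmonic_gt0 R k) Di; exists z.
pose r k := x - A (z k).
have rb : bounded_seq r.
  exists (inf D + 1) => k; apply: le_trans (ltW (zP k)) _; rewrite lerD2l.
  by rewrite /harmonic/= invf_le1// ler1n.
have almost_orth k y : dot (r k) (A y) ^+ 2 <= harmonic k * dot (A y) (A y).
  apply: discriminant_le; first exact: dot_ge0.
  move=> t; have : inf D <= dot (x - A (z k - t *: y)) (x - A (z k - t *: y)).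
    by apply: ge_inf => //; exists (z k - t *: y).
  have -> : x - A (z k - t *: y) = r k + t *: A y.
    by rewrite symB// symZ// opprB addrA /r addrAC.
  have := zP k; rewrite -/(r k) !dotE.
  rewrite (dotC (A y) x) (dotC (A y) (A (z k))).
  rewrite expr2; lra.
have [U [UU oU]] := ultra_eventually.
have h0 : harmonic k @[k --> U] --> (0 : R) by apply: (cvg_finer oU); exact: cvg_harmonic.
have [w rw] := ultra_wcvg UU rb.
have Aw : A w = 0.
  apply: dot_ext => y; rewrite sA dot0l.
  have c : dot (r k) (A y) @[k --> U] --> (0 : R).
    apply: cvg0_sqr; apply: (@cvg0_le _ _ _ _ (fun k => harmonic k * dot (A y) (A y))).
      by move=> k; rewrite ger0_norm ?sqr_ge0.
    by rewrite -[X in _ --> X](mul0r (dot (A y) (A y))); apply: cvgM => //; exact: cvg_cst.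
  exact: (cvg_unique _ (rw (A y)) c).
have c1 : dot (r k) x @[k --> U] --> (0 : R).
  by rewrite -(kA w Aw) dotC; exact: rw.
have [M rM] := rb.
pose M' := 2 * dot x x + 2 * M.
have c2 : dot (r k) (A (z k)) @[k --> U] --> (0 : R).
  apply: cvg0_sqr; apply: (@cvg0_le _ _ _ _ (fun k => harmonic k * M')).
    move=> k; rewrite ger0_norm ?sqr_ge0//; apply: le_trans (almost_orth k (z k)) _.
    rewrite ler_wpM2l ?harmonic_ge0//.
    have -> : A (z k) = x + - r k by rewrite /r opprB addrC subrK.
    by apply: le_trans (dotD_le _ _) _; rewrite /M' dotNl dotNr opprK; have := rM k; lra.
  by rewrite -[X in _ --> X](mul0r M'); apply: cvgM => //; exact: cvg_cst.
have c3 : (dot (r k) x - dot (r k) (A (z k))) @[k --> U] --> (0 : R).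
  by rewrite -[X in _ --> X](subr0 0); apply: cvgB.
have [k ke] := filter_ex (cvg0_lt c3 e0).
exists (z k); apply: le_lt_trans ke.
by rewrite -dotBr -[A (z k) - x]opprB dotNl dotNr opprK ler_norm.
Qed.

End Operators.

(** * The Vakhitov-Kolokolov dichotomy *)

Section VakhitovKolokolov.
Variables (R : realType) (T : choiceType).
Local Notation H := (l2 R T).
Variables (Lp Lm : H -> H) (phi psi : H) (kappa : R).
Hypotheses (sLp : symmetric_op Lp) (sLm : symmetric_op Lm).
Hypotheses (Lm_phi : Lm phi = 0) (pLm : psd_op Lm).
Hypothesis Lp_index : forall h, dot h psi = 0 -> 0 <= dot (Lp h) h.
Hypotheses (kappa0 : 0 < kappa) (Lp_phi : Lp phi = - kappa *: psi).
Hypothesis phi_psi : 0 < dot phi psi.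
Implicit Types (x y z : H).

Let phi_gt0 : 0 < dot phi phi.
Proof.
rewrite lt_neqAle dot_ge0 andbT eq_sym; apply: contraL phi_psi => /eqP/dot_eq0 ->.
by rewrite dot0l ltxx.
Qed.

(** If [<Lp x, x> < 0] with [x] orthogonal to [phi = Lp y], then [x] and [y] are
    orthogonal for the form of [Lp], and both have nonpositive form value.  Some
    combination of them is orthogonal to [psi], and its coefficient on [x] is
    [<y, psi>], which does not vanish as [kappa <y, psi> = - |phi|^2].  This
    contradicts [Lp_index]. *)
Lemma vk_nonneg y x : Lp y = phi -> dot y phi <= 0 -> dot x phi = 0 ->
  0 <= dot (Lp x) x.
Proof.
move=> Ly y0 x0; rewrite leNgt; apply/negP => xneg.
have ypsi : kappa * dot y psi = - dot phi phi.
  rewrite -{1}Ly sLp Lp_phi dotZr; ring.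
have a0 : dot y psi != 0.
  by apply: contraTneq phi_gt0 => a0; move: ypsi; rewrite a0 mulr0 => ?; rewrite -leNgt; lra.
pose z := dot y psi *: x + - dot x psi *: y.
have : 0 <= dot (Lp z) z by apply: Lp_index; rewrite /z !dotE; ring.
have xy : dot (Lp x) y = 0 by rewrite sLp Ly.
rewrite /z sym_quadD// symZ// Ly !dotE xy.
have : 0 < dot y psi ^+ 2 by rewrite lt_neqAle sqr_ge0 eq_sym sqrf_eq0 a0.
rewrite (dotC phi y); have := sqr_ge0 (dot x psi); nra.
Qed.

(** The witness is the projection of [phi] along [y] onto the orthogonal of
    [phi]; the form equals [- kappa <psi, phi> - |phi|^4 / <y, phi>] on it. *)
Lemma vk_negative y : Lp y = phi -> 0 < dot y phi ->
  exists2 x, dot x phi = 0 & dot (Lp x) x < 0.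
Proof.
move=> Ly y0; exists (phi + - (dot phi phi / dot y phi) *: y).
  by rewrite !dotE; field; rewrite gt_eqF.
rewrite sym_quadD// (sLp phi y) Ly (dotC phi y) Lp_phi dotZl (dotC psi).
set t := dot phi phi / _; have t0 : 0 < t by rewrite divr_gt0.
have tE : t * dot y phi = dot phi phi by rewrite /t divfK// gt_eqF.
have : 0 < kappa * dot phi psi by rewrite mulr_gt0.
have : 0 < t * dot phi phi by rewrite mulr_gt0.
have -> : (- t) ^+ 2 * dot y phi = t * dot phi phi by rewrite -tE; ring.
lra.
Qed.

Hypothesis Lm_ker : forall z, Lm z = 0 -> exists a, z = a *: phi.
Variables (C : R).
Hypotheses (Lp_bound : forall x, `|dot (Lp x) x| <= C * dot x x)
           (Lm_bound : forall x, dot (Lm x) x <= C * dot x x).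
Hypotheses (wLp : weakly_coercive Lp) (wLm : weakly_coercive Lm).

Let C_ge0 : 0 <= C.
Proof.
have := le_trans (normr_ge0 _) (Lp_bound phi).
by rewrite pmulr_lge0.
Qed.

Let Lm_sqr_le z : dot (Lm z) (Lm z) <= C * dot (Lm z) z.
Proof.
have [z0|z0] := eqVneq (dot (Lm z) (Lm z)) 0.
  by rewrite z0 mulr_ge0.
have zp : 0 < dot (Lm z) (Lm z) by rewrite lt_neqAle eq_sym z0 dot_ge0.
rewrite -(ler_pM2l zp) -expr2; apply: le_trans (psd_CauchySchwarz _ _ sLm pLm) _.
by have := Lm_bound (Lm z); have := pLm z; nra.
Qed.

(* The eigenvalue problem [Lm (Lp x) = - m x] is attacked through [x = Lm z],
   which turns it into a variational problem for the two forms [P] and [N]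
   without inverting [Lm]. *)
Let P z := dot (Lp (Lm z)) (Lm z).
Let N z := dot (Lm z) z.

(** A negative direction of [Lp] orthogonal to [phi] can be approximated inside
    the range of [Lm]. *)
Lemma vk_negative_range x : dot x phi = 0 -> dot (Lp x) x < 0 ->
  exists z, P z < 0.
Proof.
move=> x0 xneg; set q := - dot (Lp x) x; have q0 : 0 < q by rewrite /q; lra.
pose m := dot (Lp x) (Lp x) + 1; have m0 : 0 < m by have := dot_ge0 (Lp x); rewrite /m; lra.
pose b := C + 4 * m / q; have b0 : 0 < b.
  by rewrite /b ltr_wpDl// divr_gt0// mulr_gt0.
have e0 : 0 < q / (4 * b) by rewrite divr_gt0// mulr_gt0.
have kx z : Lm z = 0 -> dot x z = 0.
  by move=> /Lm_ker[a ->]; rewrite dotZr x0 mulr0.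
have [z zx] := range_dense sLm kx e0; exists z; rewrite /P.
have : Lm z = x + 1 *: (Lm z - x) by rewrite scale1r addrC subrK.
move: (Lm z - x) zx => e ee ->; rewrite sym_quadD//.
have ee' : dot e e * (4 * b) < q by rewrite -ltr_pdivlMr// mulr_gt0.
have h1 : dot (Lp e) e <= C * dot e e by apply: le_trans (Lp_bound e); exact: ler_norm.
have h2 : 2 * dot (Lp x) e <= q / (4 * m) * dot (Lp x) (Lp x) + 4 * m / q * dot e e.
  have := dot_ge0 ((q / (4 * m)) *: Lp x - e); rewrite !dotE (dotC e).
  set s := q / (4 * m); have s0 : 0 < s by rewrite divr_gt0// mulr_gt0.
  have -> : 4 * m / q = s^-1 by rewrite /s invf_div.
  have sE : s * (s^-1 * dot e e) = dot e e by rewrite mulVKf// gt_eqF.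
  by move=> h; rewrite -(ler_pM2l s0) [s * (_ + _)]mulrDr sE; lra.
have h3 : q / (4 * m) * dot (Lp x) (Lp x) <= q / 4.
  rewrite -mulrA ler_pM2l// mulrC ler_pdivrMr ?mulr_gt0// /m; lra.
have -> : dot (Lp x) x = - q by rewrite /q opprK.
have : (C + 4 * m / q) * dot e e < q / 4 by rewrite -/b; lra.
rewrite mulrDl; lra.
Qed.

Let S : set R := [set m | 0 <= m /\ forall z, 0 <= P z + m * N z].

Let S_inf : has_inf S.
Proof.
split; last by exists 0 => m [].
exists (C * C); split; first by rewrite mulr_ge0.
move=> z; have := Lp_bound (Lm z); rewrite -/(P z) ler_norml => /andP[h _].
have := ler_wpM2l C_ge0 (Lm_sqr_le z); rewrite -/(N z) mulrA; lra.
Qed.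

Let S_min : S (inf S).
Proof.
split; first by apply: lb_le_inf; [exact: S_inf.1|move=> m []].
move=> z; rewrite leNgt; apply/negP => neg.
have N0 : 0 <= N z := pLm z.
have e0 : 0 < - (P z + inf S * N z) / (N z + 1) by rewrite divr_gt0; lra.
have [m [m0 mz] mlt] := inf_adherent e0 S_inf.
have := mz z; have : (m - inf S) * (N z + 1) < - (P z + inf S * N z).
  by rewrite -ltr_pdivlMr; lra.
have : 0 <= m - inf S by rewrite subr_ge0; apply: ge_inf S_inf.2 _ _; split.
nra.
Qed.

(* The last term removes [phi], which is always in the kernel of the form. *)
Let A m z := Lm (Lp (Lm z)) + m *: Lm z + dot z phi *: phi.

Let A_sym m : symmetric_op (A m).
Proof.
move=> x y; rewrite /A !dotE !sLm !sLp sLm (dotC phi y) -(dotC (Lm y)); ring.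
Qed.

Let A_quad m z : dot (A m z) z = P z + m * N z + dot z phi ^+ 2.
Proof. by rewrite /A !dotE sLm (dotC phi z) -expr2. Qed.

Let A_wc m : 0 <= m -> weakly_coercive (A m).
Proof.
move=> m0; have [w [K [w0 LK Kc]]] := wLp.
have [v [K' [v0 LK' Kc']]] := weakly_coercive_sqr sLm wLm.
exists (w * v), (fun z => K (Lm z) + w * K' z); split.
- by rewrite mulr_gt0.
- move=> z; rewrite A_quad.
  have h1 := LK (Lm z); have := LK' z; rewrite /= sLm => h2.
  have := ler_wpM2l (ltW w0) h2; rewrite mulrA.
  have := sqr_ge0 (dot z phi); have := mulr_ge0 m0 (pLm z); rewrite -/(P z) -/(N z).
  move: h1; rewrite -/(P z); lra.
- move=> U r UU rb r0; rewrite -[X in _ --> X](_ : 0 + w * 0 = 0); last by rewrite mulr0 addr0.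
  apply: cvgD; last by apply: cvgM; [exact: cvg_cst|exact: Kc'].
  apply: Kc => //; last by rewrite -(sym0 sLm); exact: sym_wcvg.
  have [M rM] := rb; exists (C * (C * M)) => k.
  apply: le_trans (Lm_sqr_le _) _; rewrite ler_wpM2l//.
  by apply: le_trans (Lm_bound _) _; rewrite ler_wpM2l.
Qed.

(** At the least admissible [m] the operator [A m] has a kernel: otherwise it
    would be coercive, and the form [P + m N], which does not see the component
    along [phi], would stay nonnegative for a slightly smaller [m]. *)
Lemma vk_growing_mode y : Lp y = phi -> 0 < dot y phi ->
  exists (mu : R) x, [/\ 0 < mu, x != 0 & Lm (Lp x) = - mu ^+ 2 *: x].
Proof.
move=> Ly y0; have [x x0 xneg] := vk_negative Ly y0.
have [z1 Pz1] := vk_negative_range x0 xneg.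
have [m_ge0 mP] := S_min; set m := inf S in m_ge0 mP.
have m_gt0 : 0 < m.
  rewrite lt_neqAle m_ge0 andbT; apply: contraTneq Pz1 => m0.
  by rewrite -leNgt; have := mP z1; rewrite -m0 mul0r addr0.
have pA : psd_op (A m).
  by move=> z; rewrite A_quad; have := mP z; have := sqr_ge0 (dot z phi); lra.
have [z [Az z0]] : exists z, A m z = 0 /\ z != 0.
  apply: contrapT => nz.
  have [|c c0 cA] := coercive_of_trivial_kernel (@A_sym m) pA (A_wc m_ge0).
    by move=> z Az; apply/eqP; apply: contrapT => /negP z0; apply: nz; exists z.
  pose e := Num.min m (c / (C + 1)).
  have C1 : 0 < C + 1 by have := C_ge0; lra.
  have e0 : 0 < e by rewrite lt_min m_gt0 divr_gt0.
  have eC : e * C <= c.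
    have : e * (C + 1) <= c by rewrite -ler_pdivlMr// ge_min lexx orbT.
    lra.
  suff /(ge_inf S_inf.2) : S (m - e) by rewrite -/m; lra.
  split; first by rewrite subr_ge0 ge_min lexx.
  move=> z; pose z' := z - (dot z phi / dot phi phi) *: phi.
  have Lz' : Lm z' = Lm z by rewrite symB// symZ// Lm_phi scaler0 subr0.
  have Nz' : N z' = N z.
    by rewrite /N Lz' /z' dotBr dotZr (sLm z phi) Lm_phi dot0r mulr0 subr0.
  have Pz' : P z' = P z by rewrite /P Lz'.
  have z'phi : dot z' phi = 0 by rewrite /z' !dotE divfK ?subrr// gt_eqF.
  have := cA z'; rewrite A_quad Nz' Pz' z'phi expr0n addr0 => h.
  have := Lm_bound z'; rewrite -/(N z') Nz' => h'.
  have := ler_wpM2l (ltW e0) h'; rewrite mulrA.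
  have := ler_wpM2r (dot_ge0 z') eC; rewrite mulrBl; lra.
have zphi : dot z phi = 0.
  have := congr1 (fun h => dot h phi) Az; rewrite /A !dotE !sLm Lm_phi !dot0r.
  by rewrite mulr0 !add0r => /eqP; rewrite mulf_eq0 (gt_eqF phi_gt0) orbF => /eqP.
exists (Num.sqrt m), (Lm z); split.
- by rewrite sqrtr_gt0.
- apply: contra_neq z0 => /Lm_ker[a za]; move: zphi; rewrite za dotZl => /eqP.
  by rewrite mulf_eq0 (gt_eqF phi_gt0) orbF => /eqP ->; rewrite scale0r.
- rewrite sqr_sqrtr// scaleNr; apply/eqP; rewrite -addr_eq0.
  by move: Az; rewrite /A zphi scale0r addr0 => /eqP.
Qed.

End VakhitovKolokolov.

(** * Schroedinger operators on the lattice *)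

Section Lattice.
Variable (d : nat).
Local Notation dir := ('I_d * bool)%type.
Implicit Types (n m : lattice d) (e : dir).

(** The unit vectors of the lattice and their opposites, indexed by an axis and
    an orientation. *)
Definition step e : lattice d := (if e.2 then 1 else -1) *: delta_mx 0 e.1.

Definition back e : dir := (e.1, ~~ e.2).

Lemma backK : involutive back. Proof. by case=> i b; rewrite /back/= negbK. Qed.

Lemma step_back e : step (back e) = - step e.
Proof. by rewrite /step /=; case: e.2; rewrite -scaleNr ?opprK. Qed.

Lemma stepE e i : step e 0 i = (if e.2 then 1 else -1) * (i == e.1)%:R.
Proof. by rewrite !mxE eqxx. Qed.

Lemma step_inj : injective step.
Proof.
move=> [i b] [j c] /rowP st; have := st i; have := st j.
rewrite !stepE /= !eqxx; have [->|ij] := eqVneq i j.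
  by case: b {st}; case: c.
by case: b {st}; case: c.
Qed.

(** A sum of squares of integers is 1 only if one term is 1 and all others
    vanish. *)
Lemma adjacentP n m : Defs.adjacent m n <-> exists e, m = n + step e.
Proof.
rewrite /Defs.adjacent; split=> [|[[i b] ->]]; last first.
  rewrite (bigD1 i)//= big1 => [|j /negbTE ji].
    by rewrite mxE addrAC subrr add0r stepE/= eqxx addr0; case: b.
  by rewrite mxE addrAC subrr add0r stepE/= ji mulr0 expr0n.
move=> s1; have sq0 j : 0 <= (m 0 j - n 0 j) ^+ 2 by exact: sqr_ge0.
have [i ki] : exists i, m 0 i - n 0 i != 0.
  apply: contrapT => nk; move: s1; rewrite big1// => i _.
  have [->|h] := eqVneq (m 0 i - n 0 i) 0; first by rewrite expr0n.
  by exfalso; apply: nk; exists i.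
move: s1; rewrite (bigD1 i)//=; set rest := \sum_(j < d | _) _ => s1.
have r0 : 0 <= rest by apply: sumr_ge0.
have k1 : 1 <= (m 0 i - n 0 i) ^+ 2.
  by rewrite -gtz0_ge1 lt_neqAle sq0 eq_sym sqrf_eq0 ki.
have rest0 : rest = 0 by lia.
have ki1 : (m 0 i - n 0 i) ^+ 2 = 1 by lia.
have kj j : j != i -> m 0 j = n 0 j.
  move=> ji; have /eqP := rest0; rewrite psumr_eq0// => /allP/(_ j).
  rewrite mem_index_enum ji/= sqrf_eq0 => /(_ isT).
  by rewrite subr_eq0 => /eqP.
move/eqP: ki1; rewrite sqrf_eq1 => /orP[] /eqP ki1.
  exists (i, true); apply/rowP => j; rewrite !mxE eqxx/=.
  have [->|/kj ->] := eqVneq j i; last by rewrite mulr0 addr0.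
  by rewrite mulr1 -ki1 addrC subrK.
exists (i, false); apply/rowP => j; rewrite !mxE eqxx/=.
have [->|/kj ->] := eqVneq j i; last by rewrite mulr0 addr0.
by rewrite mulr1 -ki1 addrC subrK.
Qed.

Lemma adjacentC n m : Defs.adjacent m n -> Defs.adjacent n m.
Proof.
move=> /adjacentP[e ->]; apply/adjacentP; exists (back e).
by rewrite step_back addrK.
Qed.

Lemma neighboursE n :
  [set m | Defs.adjacent m n] = [set` [seq n + step e | e <- enum {: dir}]].
Proof.
apply/seteqP; split=> m /=.
  by move=> /adjacentP[e ->]; apply: map_f; rewrite mem_enum.
by move=> /mapP[e _ ->]; apply/adjacentP; exists e.
Qed.

Lemma neighbours_uniq n : uniq [seq n + step e | e <- enum {: dir}].
Proof. by rewrite map_inj_uniq ?enum_uniq// => e f /addrI/step_inj. Qed.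

Lemma laplacianE (V : zmodType) (u : lattice d -> V) n :
  laplacian u n = \sum_e u (n + step e) - u n *+ (2 * d).
Proof.
rewrite /laplacian neighboursE -fsbig_seq ?neighbours_uniq//.
by rewrite big_map big_enum.
Qed.

(** Induction on the l1 norm of the difference. *)
Lemma lattice_connected (P : lattice d -> Prop) n m :
  (forall k e, P k -> P (k + step e)) -> P n -> P m.
Proof.
move=> Pstep Pn; rewrite -(subrK n m) addrC; move: (m - n) => k {m}.
move: {2}(\sum_i `|k 0%R i|)%N (leqnn (\sum_i `|k 0%R i|)%N) => N.
elim: N k => [|N IH] k kN.
  suff -> : k = 0 by rewrite addr0.
  apply/rowP => i; rewrite mxE; apply/eqP; rewrite -absz_eq0 -leqn0.
  by apply: leq_trans kN; rewrite (bigD1 i)//= leq_addr.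
have [->|/eqP k0] := eqVneq k 0; first by rewrite addr0.
have [i ki] : exists i, k 0 i != 0.
  apply: contrapT => nk; apply: k0; apply/rowP => i; rewrite mxE.
  by apply/eqP; apply: contrapT => /negP ki; apply: nk; exists i.
pose e : dir := (i, 0 < k 0 i).
rewrite -(subrK (step e) k) addrA; apply: Pstep; apply: IH.
move: kN; rewrite (bigD1 i)//= [X in _ -> (X <= _)%N](bigD1 i)//=.
have -> : (\sum_(j < d | j != i) `|((k - step e) 0 j)%R| = \sum_(j < d | j != i) `|k 0%R j|)%N.
  by apply: eq_bigr => j /negbTE ji; rewrite !mxE eqxx/= ji mulr0 subr0.
have -> : (k - step e) 0 i = k 0 i - (if 0 < k 0 i then 1 else -1).
  by rewrite !mxE !eqxx /= mulr1.
move: (\sum_(j < d | j != i) `|k 0%R j|)%N (k 0 i) ki => S z z0 {e}.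
by case: ifP => h; lia.
Qed.

End Lattice.

Section LatticeOperators.
Variables (R : realType) (d : nat).
Local Notation L := (lattice d).
Local Notation dir := ('I_d * bool)%type.
Local Notation H := (l2 R L).
Implicit Types (x y : H) (e : dir) (w : R) (V : L -> R).

Lemma bij_step e : bijective (fun n : L => n + step e).
Proof. by exists (fun n => n - step e) => n; rewrite ?addrK ?subrK. Qed.

Definition shift e x : H := toL2 (fun n => x (n + step e)).

Lemma shiftE e x n : shift e x n = x (n + step e).
Proof.
rewrite /shift toL2E//; apply/sqsummP.
have /sqsummP := l2P x; exact: (summ_bij (f := fun n => x n ^+ 2) (bij_step e)).
Qed.

Lemma dot_shift e x y : dot (shift e x) y = dot x (shift (back e) y).
Proof.
rewrite /dot -[RHS](tsum_bij _ (bij_step e)); apply: eq_tsum => n /=.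
by rewrite !shiftE step_back addrK.
Qed.

Definition nbr_sum x : H := \sum_e shift e x.

Lemma nbr_sumE x n : nbr_sum x n = \sum_e x (n + step e).
Proof.
rewrite /nbr_sum (big_morph (fun z : H => z n) (fun y z => l2D y z n) (l20 R n)).
by apply: eq_bigr => e _; rewrite shiftE.
Qed.

Lemma dot_suml (I : Type) (r : seq I) (f : I -> H) y :
  dot (\sum_(i <- r) f i) y = \sum_(i <- r) dot (f i) y.
Proof. exact: (big_morph (fun z => dot z y) (fun a b => dotDl a b y) (dot0l y)). Qed.

Lemma nbr_sum_sym : symmetric_op nbr_sum.
Proof.
move=> x y; rewrite [RHS]dotC !dot_suml (reindex_inj (inv_inj (@backK d)))/=.
by apply: eq_bigr => e _; rewrite dot_shift backK dotC.
Qed.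

(** This is [- Delta + w], with the diagonal part of [- Delta] put in the
    scalar. *)
Definition Aop w x : H := (w + (2 * d)%:R) *: x - nbr_sum x.

Lemma AopE w x n : Aop w x n = - laplacian x n + w * x n.
Proof.
rewrite /Aop l2B l2Z nbr_sumE laplacianE -mulr_natl; ring.
Qed.

Lemma Aop_sym w : symmetric_op (Aop w).
Proof. by move=> x y; rewrite /Aop !dotE nbr_sum_sym. Qed.

Lemma dot_shift_self e x : dot (shift e x) (shift e x) = dot x x.
Proof.
rewrite dot_shift; congr dot; apply: l2_ext => n.
by rewrite !shiftE step_back subrK.
Qed.

Lemma card_dir : #|{: dir}| = (2 * d)%N.
Proof. by rewrite card_prod card_ord card_bool mulnC. Qed.

Lemma Aop_quad w x : dot (Aop w x) x =
  2^-1 * (\sum_e dot (x - shift e x) (x - shift e x)) + w * dot x x.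
Proof.
have -> : \sum_e dot (x - shift e x) (x - shift e x) =
    2 * ((2 * d)%:R * dot x x - \sum_e dot (shift e x) x).
  have -> : (2 * d)%:R * dot x x = \sum_(e : dir) dot x x.
    by rewrite sumr_const card_dir mulr_natl.
  rewrite -sumrB mulr_sumr; apply: eq_bigr => e _.
  by rewrite !dotE dot_shift_self (dotC x (shift e x)); ring.
by rewrite /Aop !dotE dot_suml; field.
Qed.

Lemma Aop_ge w x : w * dot x x <= dot (Aop w x) x.
Proof.
rewrite Aop_quad lerDr mulr_ge0// sumr_ge0// => e _; exact: dot_ge0.
Qed.

Lemma Aop_le w x : dot (Aop w x) x <= (2 * (2 * d)%:R + w) * dot x x.
Proof.
rewrite Aop_quad mulrDl lerD2r.
have -> : 2 * (2 * d)%:R * dot x x = 2^-1 * \sum_(e : dir) 4 * dot x x.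
  by rewrite sumr_const card_dir -mulr_natl; field.
rewrite ler_wpM2l// ler_sum// => e _; apply: le_trans (dotD_le _ _) _.
by rewrite dotNl dotNr opprK dot_shift_self; lra.
Qed.

Lemma Aop_bound w : 0 <= w -> exists2 C : R, 0 <= C &
  forall x, `|dot (Aop w x) x| <= C * dot x x.
Proof.
move=> w0; exists (2 * (2 * d)%:R + w); first by rewrite addr_ge0// mulr_ge0.
move=> x; rewrite ger0_norm ?Aop_le//.
by apply: le_trans (Aop_ge w _); rewrite mulr_ge0 ?dot_ge0.
Qed.

Lemma mulL2_sym V : vanishing V -> symmetric_op (mulL2 V).
Proof.
by move=> vV x y; apply: eq_tsum => n; rewrite !mulL2E//; ring.
Qed.

Lemma mulL2_bound V : vanishing V -> exists2 C : R, 0 <= C &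
  forall x, `|dot (mulL2 V x) x| <= C * dot x x.
Proof.
move=> vV; have [C VC] := vanishing_bounded vV.
have C0 : 0 <= C by apply: le_trans (VC 0).
exists C => // x.
have s1 : summ (fun n => mulL2 V x n * x n) by exact: summM (l2P _) (l2P _).
have s2 : summ (fun n => C * (x n * x n)) by exact/summZ/(summM (l2P _) (l2P _)).
have xx n : 0 <= x n * x n by rewrite -expr2 sqr_ge0.
rewrite -tsumZ; last exact: summM (l2P _) (l2P _).
rewrite ler_norml -tsumN; apply/andP; split; apply: le_tsum => //; first exact: summN.
  move=> n; rewrite mulL2E// -mulrA -mulNr ler_wpM2r//.
  by have := VC n; rewrite ler_norml => /andP[].
move=> n; rewrite mulL2E// -mulrA ler_wpM2r//.
by have := VC n; rewrite ler_norml => /andP[].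
Qed.

Definition Lop w V x : H := Aop w x - mulL2 V x.

Section Schroedinger.
Variables (w : R) (V : L -> R).
Hypotheses (w0 : 0 < w) (vV : vanishing V).

Lemma LopE x n : Lop w V x n = - laplacian x n + w * x n - V n * x n.
Proof. by rewrite /Lop l2B AopE mulL2E. Qed.

Lemma Lop_sym : symmetric_op (Lop w V).
Proof. by move=> x y; rewrite /Lop dotBl dotBr Aop_sym mulL2_sym. Qed.

Lemma Lop_bound : exists2 C : R, 0 <= C &
  forall x, `|dot (Lop w V x) x| <= C * dot x x.
Proof.
have [C C0 VC] := mulL2_bound vV.
have D0 : 0 <= (2 * d)%:R :> R by exact: ler0n.
have w0' := w0.
exists (2 * (2 * d)%:R + w + C); first by move: ((2 * d)%:R : R) D0 => D D0; lra.
move=> x; have := VC x; rewrite /Lop dotBl !ler_norml => /andP[h1 h2].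
have := Aop_ge w x; have := Aop_le w x; have := dot_ge0 x.
move: ((2 * d)%:R : R) D0 (dot x x) h1 h2 => D D0 X h1 h2 X0 h3 h4.
have : 0 <= D * X by rewrite mulr_ge0.
have : 0 <= w * X by rewrite mulr_ge0 ?(ltW w0).
by move=> *; apply/andP; split; lra.
Qed.

Lemma Lop_weakly_coercive : weakly_coercive (Lop w V).
Proof.
exists w, (fun x => dot (mulL2 V x) x); split=> //.
  by move=> x; rewrite /Lop dotBl subrK Aop_ge.
move=> U r UU rb r0; have [M rM] := rb; apply: cvg0_sqr.
apply: (@cvg0_le _ _ _ _ (fun k => dot (mulL2 V (r k)) (mulL2 V (r k)) * M)).
  move=> k; rewrite ger0_norm ?sqr_ge0//; apply: le_trans (CauchySchwarz _ _) _.
  by rewrite ler_wpM2l// dot_ge0.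
rewrite -[X in _ --> X](mul0r M); apply: cvgM; last exact: cvg_cst.
exact: mulL2_compact.
Qed.

Variable (phi : H).
Hypotheses (phi0 : forall n, 0 < phi n) (Lphi : Lop w V phi = 0).

Let pot n := w + (2 * d)%:R - V n.

Let potE n : pot n * phi n = \sum_e phi (n + step e).
Proof.
have := congr1 (fun x : H => x n) Lphi.
rewrite LopE laplacianE l20 -mulr_natl /pot; lra.
Qed.

Let g x e n := phi (n + step e) / phi n * (x n * x n).

Let sum_g x n : \sum_e g x e n = pot n * (x n * x n).
Proof. by rewrite -mulr_suml -mulr_suml -potE mulfK// gt_eqF. Qed.

Let g_ge0 x e n : 0 <= g x e n.
Proof. by rewrite mulr_ge0 ?divr_ge0 ?(ltW (phi0 _))// -expr2 sqr_ge0. Qed.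

Let summ_pot x : summ (fun n => pot n * (x n * x n)).
Proof.
have := summM (l2P ((w + (2 * d)%:R) *: x - mulL2 V x)) (l2P x).
by congr summ; apply/funext => n; rewrite l2B l2Z mulL2E// /pot; ring.
Qed.

Let summ_g x e : summ (g x e).
Proof.
apply: summ_le (summ_pot x) => n; rewrite -sum_g !ger0_norm ?sumr_ge0//.
by rewrite (bigD1 e)//= lerDl sumr_ge0.
Qed.

Let h x e n := g x e n + g x (back e) (n + step e) - 2 * (x (n + step e) * x n).

Let hE x e n : h x e n =
  (phi (n + step e) * x n - phi n * x (n + step e)) ^+ 2 / (phi n * phi (n + step e)).
Proof.
by rewrite /h /g step_back addrK; field; rewrite !gt_eqF.
Qed.

Let h_ge0 x e n : 0 <= h x e n.
Proof. by rewrite hE divr_ge0 ?sqr_ge0// mulr_ge0 ?ltW. Qed.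

Let summ_gb x e : summ (fun n => g x (back e) (n + step e)).
Proof. exact: (summ_bij (bij_step e) (summ_g x (back e))). Qed.

Let summ_x x e : summ (fun n => x (n + step e) * x n).
Proof.
have := summM (l2P (shift e x)) (l2P x).
by congr summ; apply/funext => n; rewrite shiftE.
Qed.

Let summ_h x e : summ (h x e).
Proof. by apply: summD; [exact: summD|exact/summN/summZ]. Qed.

(** With [v = x / phi] the right-hand side is the sum over oriented edges
    [(n, m)] of [phi n * phi m * (v m - v n)^2].  Replacing the diagonal of the
    operator by [(\sum_m phi m) / phi n], which is allowed because
    [Lop w V phi = 0], gives a sum over oriented edges; it is then symmetrized
    by reversing the edges. *)
Lemma ground_state_identity x :
  2 * dot (Lop w V x) x = \sum_e tsum (h x e).
Proof.
have E1 e : tsum (h x e) = tsum (g x e) + tsum (g x (back e)) - 2 * dot (shift e x) x.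
  rewrite /h tsumD; [|exact: summD|exact/summN/summZ].
  rewrite tsumD// tsumN tsumZ// -[tsum (g x (back e))](tsum_bij _ (bij_step e)).
  congr (_ - 2 * _); apply: eq_tsum => n; by rewrite shiftE.
rewrite (eq_bigr _ (fun e _ => E1 e)) sumrB big_split/= -mulr_sumr.
have -> : \sum_e tsum (g x (back e)) = \sum_e tsum (g x e).
  by rewrite [RHS](reindex_inj (inv_inj (@backK d))).
rewrite -(tsum_big _ (summ_g x)).2 (eq_tsum (sum_g x)).
rewrite -dot_suml -/(nbr_sum x); set A := tsum _; set B := dot (nbr_sum x) x.
have -> : A + A - 2 * B = 2 * (A - B) by ring.
congr (_ * _); rewrite /Lop /Aop -addrA addrCA addrC dotBl; congr (_ - _).
by apply: eq_tsum => n; rewrite l2B l2Z mulL2E// /pot; ring.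
Qed.

Lemma Lop_psd : psd_op (Lop w V).
Proof.
move=> x; rewrite -(@pmulr_rge0 _ 2)// ground_state_identity.
by apply: sumr_ge0 => e _; apply: tsum_ge0.
Qed.

(** All squares in [ground_state_identity] vanish, so [x / phi] is constant along
    edges. *)
Lemma Lop_ker x : Lop w V x = 0 -> exists a, x = a *: phi.
Proof.
move=> Lx; have := ground_state_identity x; rewrite Lx dot0l mulr0 => /esym/eqP.
rewrite psumr_eq0 => [/allP s0|e _]; last exact: tsum_ge0.
have key n e : phi (n + step e) * x n = phi n * x (n + step e).
  have := s0 e; rewrite mem_index_enum => /(_ isT)/eqP t0.
  have : h x e n <= 0.
    rewrite -t0 tsum_psum//.
    have := @psum_ge_fin _ _ (h x e) [:: n]; rewrite big_seq1; exact.
  move=> /(conj (h_ge0 x e n))/andP; rewrite -eq_le hE eq_sym mulf_eq0 sqrf_eq0.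
  by rewrite invr_eq0 (gt_eqF (mulr_gt0 _ _))// orbF subr_eq0 => /eqP.
exists (x 0 / phi 0); apply: l2_ext => n; rewrite l2Z.
apply: (lattice_connected (P := fun n => x n = x 0 / phi 0 * phi n) (n := 0)) => [k e IH|].
  by apply: (mulfI (lt0r_neq0 (phi0 k))); rewrite -key IH; ring.
by rewrite divfK// gt_eqF.
Qed.

End Schroedinger.

Lemma mem_lp2P (u : L -> R) : mem_lp 2 u <-> u \in @sqsumm R L.
Proof.
have e : (fun n => (`|u n| `^ 2)%:E) = (fun n => (u n ^+ 2)%:E).
  by apply/funext => n; rewrite powR_mulrn// real_normK ?num_real.
by rewrite /mem_lp e; split => [h|/sqsummP//]; exact/sqsummP.
Qed.

Lemma lp_norm2E x : lp_norm 2 x ^+ 2 = dot x x.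
Proof.
rewrite /lp_norm -powR_mulrn ?powR_ge0// -powRrM mulVf ?pnatr_eq0// powRr1.
  rewrite /dot tsum_psum; [|by move=> n; rewrite -expr2 sqr_ge0|exact: summM (l2P _) (l2P _)].
  rewrite /psum; congr fine; apply: eq_esum => n _; congr EFin.
  by rewrite powR_mulrn// real_normK ?num_real// expr2.
by apply: fine_ge0; apply: esum_ge0 => n _; rewrite lee_fin powR_ge0.
Qed.

Lemma dirichlet_energyE x : dirichlet_energy x = dot (Aop 0 x) x.
Proof.
rewrite Aop_quad mul0r addr0 /dirichlet_energy; congr (_ * _).
pose f (p q : L) : \bar R := (`|x p - x q| ^+ 2)%:E.
have f0 p q : (0 <= f p q)%E by rewrite lee_fin sqr_ge0.
have -> : \esum_(e in [set e : L * L | Defs.adjacent e.1 e.2]) (`|x e.1 - x e.2| ^+ 2)%:E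
   = \esum_(n in [set: L]) \esum_(m in [set m | Defs.adjacent m n]) f n m.
  rewrite esum_esum//; congr esum; apply/seteqP; split=> -[p q] /=.
    by move=> /adjacentC pq; split.
  by move=> [_ /adjacentC].
have -> : \esum_(n in [set: L]) \esum_(m in [set m | Defs.adjacent m n]) f n m =
   \esum_(n in [set: L]) \sum_(e : dir) f n (n + step e).
  apply: eq_esum => n _; rewrite neighboursE esum_fset//; last exact: finite_seq.
  by rewrite -fsbig_seq ?neighbours_uniq// big_map big_enum.
rewrite esum_sum//.
have E e : \esum_(n in [set: L]) f n (n + step e) = (dot (x - shift e x) (x - shift e x))%:E.
  have xx n : 0 <= (x - shift e x) n * (x - shift e x) n by rewrite -expr2 sqr_ge0.
  rewrite /dot tsum_psum//; last exact: summM (l2P _) (l2P _).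
  rewrite -psumE//; last exact: summM (l2P _) (l2P _).
  apply: eq_esum => n _; rewrite /f; congr EFin.
  by rewrite real_normK ?num_real// expr2 l2B shiftE.
by rewrite (eq_bigr _ (fun e _ => E e)) sumEFin.
Qed.

Lemma JE w x : J w x = dot (Aop w x) x.
Proof.
by rewrite /J dirichlet_energyE lp_norm2E !Aop_quad mul0r addr0.
Qed.

End LatticeOperators.

(** * Second order expansion of powers *)

Section PowerTaylor.
Variable (R : realType).
Implicit Types (r x b : R).

Lemma powR_difference_quotient (a : R) :
  ((1 + x) `^ a - 1) / x @[x --> (0 : R)^'] --> a.
Proof.
have h := @is_derive1_powR R a 1 ltr01.
have := @ex_derive _ _ _ _ _ _ _ h.
rewrite /derivable => /cvgP; rewrite -/(derive _ _ _) (@derive_val _ _ _ _ _ _ _ h).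
rewrite !powR1 mulr1; apply: cvg_trans; apply: near_eq_cvg; near=> x.
by rewrite /= /GRing.scale/= mulr1 [x + 1]addrC mulrC.
Unshelve. all: end_near. Qed.

Lemma is_derive_shift_powR (a x : R) : -1 < x ->
  is_derive x 1 (fun y : R => (1 + y) `^ a) (a * (1 + x) `^ (a - 1)).
Proof.
move=> x1; have x0 : 0 < 1 + x by lra.
have h2 : is_derive x (1 : R) (fun y : R => 1 + y) 1.
  by have := is_deriveD (is_derive_cst (1 : R) x 1) (is_derive_id x (1 : R)); rewrite add0r.
have := @is_derive1_comp R (fun z => z `^ a) (fun y => 1 + y) x _ _ (is_derive1_powR a x0) h2.
by rewrite mulr1.
Qed.

Lemma powR_second_order (a : R) :
  ((1 + x) `^ a - 1 - a * x) / x ^+ 2 @[x --> (0 : R)^'] --> a * (a - 1) / 2.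
Proof.
pose f x : R := (1 + x) `^ a - 1 - a * x; pose df x : R := a * (1 + x) `^ (a - 1) - a.
pose g x : R := x ^+ 2; pose dg x : R := 2 * x.
have fdf x : -1 < x -> is_derive x 1 f (df x).
  move=> x1; have h := is_derive_shift_powR a x1.
  have h2 : is_derive x (1 : R) (fun y : R => a * y) a.
    by have := is_deriveZ a (is_derive_id x (1 : R)); rewrite [a *: _]mulr1.
  by have := is_deriveB (is_deriveB h (is_derive_cst (1 : R) x 1)) h2; rewrite subr0.
have gdg x : is_derive x 1 g (dg x).
  by have := is_deriveX 2 (is_derive_id x (1 : R)); rewrite [_ *: _]mulr1.
have cf : f x @[x --> (0 : R)] --> (0 : R).
  have : {for 0, continuous f}.
    by apply/differentiable_continuous/derivable1_diffP; apply: ex_derive; apply: fdf; lra.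
  have f0 : f 0 = 0 by rewrite /f addr0 powR1 subrr mulr0 subr0.
  by rewrite /prop_for /continuous_at /= f0.
have cg : g x @[x --> (0 : R)] --> (0 : R).
  have : {for 0, continuous g}.
    by apply/differentiable_continuous/derivable1_diffP; apply: ex_derive; apply: gdg.
  have g0 : g 0 = 0 by rewrite /g expr0n.
  by rewrite /prop_for /continuous_at /= g0.
have dq : df x / dg x @[x --> (0 : R)^'] --> a * (a - 1) / 2.
  have : a / 2 * (((1 + x) `^ (a - 1) - 1) / x) @[x --> (0 : R)^'] --> a / 2 * (a - 1).
    by apply: cvgM; [exact: cvg_cst|exact: powR_difference_quotient].
  rewrite mulrAC; apply: cvg_trans; apply: near_eq_cvg; near=> x.
  rewrite /df /dg /=; field; near: x; exact: nbhs_dnbhs_neq.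
apply: (@cvg_at_right_left_dnbhs _ R^o).
- apply: (@lhopital_at_right R f df g dg 0 1) => //.
  + by move=> x; rewrite in_itv/= => /andP[x0 _]; apply: fdf; lra.
  + exact: cvg_at_right_filter.
  + exact: cvg_at_right_filter.
  + by move=> x; rewrite in_itv/= => /andP[x0 _]; rewrite /dg mulf_neq0// gt_eqF.
  + exact: cvg_dnbhs_at_right.
- apply: (@lhopital_at_left R f df g dg (-1) 0) => //.
  + by move=> x; rewrite in_itv/= => /andP[x0 _]; apply: fdf; lra.
  + exact: cvg_at_left_filter.
  + exact: cvg_at_left_filter.
  + by move=> x; rewrite in_itv/= => /andP[_ x0]; rewrite /dg mulf_neq0// lt_eqF.
  + exact: cvg_dnbhs_at_left.
Unshelve. all: end_near. Qed.
End PowerTaylor.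

(** * Positive minimizers and their variations *)

Section StrongConvergence.
Variables (R : realType) (T : choiceType).
Local Notation H := (l2 R T).

Lemma strong_quad_cvg (F : set_system nat) (FF : ProperFilter F) (A : H -> H)
    (r : nat -> H) z (C : R) :
  symmetric_op A -> (forall x, `|dot (A x) x| <= C * dot x x) ->
  dot (r k - z) (r k - z) @[k --> F] --> (0 : R) ->
  dot (A (r k)) (r k) @[k --> F] --> dot (A z) z.
Proof.
move=> sA AC rz; have wz := strong_wcvg FF rz.
apply: (cvg_eq (f := fun k => dot (A z) z + 2 * (dot (r k) (A z) - dot z (A z))
    + dot (A (r k - z)) (r k - z))).
  move=> k; have rE : r k = z + 1 *: (r k - z) by rewrite scale1r addrC subrK.
  rewrite -dotBl [in RHS]rE (sym_quadD _ _ _ sA) (dotC (A z) (r k - z)); ring.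
rewrite -[X in _ --> X](_ : dot (A z) z + 2 * 0 + 0 = _); last by rewrite mulr0 !addr0.
apply: cvgD.
  apply: cvgD; first exact: cvg_cst.
  by apply: cvgM; [exact: cvg_cst|apply/subr_cvg0; exact: wz].
apply: (@cvg0_le _ _ _ _ (fun k => C * dot (r k - z) (r k - z))) => //.
by rewrite -[X in _ --> X](mulr0 C); apply: cvgM => //; exact: cvg_cst.
Qed.

End StrongConvergence.

Section Minimizer.
Variables (R : realType) (d : nat) (s w : R).
Local Notation L := (lattice d).
Local Notation H := (l2 R L).
Hypotheses (s0 : 0 < s) (w0 : 0 < w).
Implicit Types (x y : H).

Let p := 2 * s + 2.

Let p_gt0 : 0 < p. Proof. by have := s0; rewrite /p; lra. Qed.
Let p_neq0 : p != 0. Proof. by rewrite gt_eqF. Qed.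

Definition pow_sum x : R := psum (fun n => `|x n| `^ (2 * s + 2)).

Lemma pow_le x n : `|x n| `^ p <= dot x x `^ s * (x n * x n).
Proof.
have -> : `|x n| `^ p = `|x n| `^ (2 * s) * (x n * x n).
  rewrite /p powRD; last by apply/implyP; rewrite gt_eqF.
  by rewrite powR_mulrn// real_normK ?num_real.
apply: ler_wpM2r; first by rewrite -expr2 sqr_ge0.
rewrite powRrM powR_mulrn// real_normK ?num_real//.
by apply: ge0_ler_powR; rewrite ?nnegrE ?(ltW s0) ?sqr_ge0 ?dot_ge0 ?coord_le.
Qed.

Lemma summ_pow x : summ (fun n => `|x n| `^ p).
Proof.
have sx : summ (fun n => dot x x `^ s * (x n * x n)).
  exact/summZ/(summM (l2P x) (l2P x)).
apply: summ_le sx => n; rewrite ger0_norm ?powR_ge0//.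
by apply: le_trans (pow_le x n) _; exact: ler_norm.
Qed.

Lemma pow_sum_tsum x : pow_sum x = tsum (fun n => `|x n| `^ p).
Proof. by rewrite tsum_psum//; exact: summ_pow. Qed.

Lemma pow_sum_ge0 x : 0 <= pow_sum x.
Proof. by apply: psum_ge0 => n; exact: powR_ge0. Qed.

Lemma pow_sum_le x : pow_sum x <= dot x x `^ s * dot x x.
Proof.
have sxx := summM (l2P x) (l2P x).
rewrite pow_sum_tsum /dot -tsumZ//; apply: le_tsum; first exact: summ_pow.
  exact: summZ.
exact: pow_le.
Qed.

Lemma admissibleP x : admissible s x <-> pow_sum x = 1.
Proof.
rewrite /admissible /lp_norm -/p -[fine _]/(pow_sum x); split=> [[_]|->].
  move=> /eqP; rewrite powR_eq1 invr_eq0 (negbTE p_neq0) orbF.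
  by rewrite ltNge pow_sum_ge0 orbF => /eqP.
by rewrite powR1; split => //; apply/mem_lp2P/l2P.
Qed.

Let values := [set J w u | u in admissible s (d := d)].

Let values_ge0 : lbound values 0.
Proof.
move=> _ [u [/mem_lp2P su _] <-]; rewrite -[u](toL2E su) JE.
by apply: le_trans (Aop_ge w _); rewrite mulr_ge0 ?(ltW w0) ?dot_ge0.
Qed.

Lemma J_inf_le x : pow_sum x = 1 -> J_inf d s w <= dot (Aop w x) x.
Proof.
move=> /admissibleP ax; rewrite -JE; apply: ge_inf; first by exists 0.
by exists x.
Qed.

(** The energy is quadratic and nonnegative, so scaling down to the constraint
    only lowers it. *)
Lemma J_inf_le_of_ge1 x : 1 <= pow_sum x -> J_inf d s w <= dot (Aop w x) x.
Proof.
move=> x1; have N0 : 0 < pow_sum x by apply: lt_le_trans x1.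
pose c := pow_sum x `^ (- p^-1).
have c0 : 0 < c by apply: powR_gt0.
have c1 : c <= 1.
  rewrite /c powRN invf_le1 ?powR_gt0// [leLHS](_ : 1 = 1 `^ p^-1); last by rewrite powR1.
  by apply: ge0_ler_powR; rewrite ?nnegrE ?invr_ge0 ?(ltW p_gt0) ?(ltW N0).
have Nc : pow_sum (c *: x) = 1.
  rewrite pow_sum_tsum (@eq_tsum _ _ _ (fun n => c `^ p * `|x n| `^ p)) => [|n].
    rewrite tsumZ; last exact: summ_pow.
    rewrite -pow_sum_tsum /c -powRrM mulNr mulVf// powRN powRr1 ?(ltW N0)//.
    by rewrite mulVf// gt_eqF.
  by rewrite l2Z normrM (ger0_norm (ltW c0)) powRM// ltW.
apply: le_trans (J_inf_le Nc) _.
have A0 : 0 <= dot (Aop w x) x.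
  by apply: le_trans (Aop_ge w _); rewrite mulr_ge0 ?(ltW w0) ?dot_ge0.
rewrite (symZ _ _ (Aop_sym w)) dotZl dotZr mulrA; apply: ler_piMl => //.
by rewrite mulr_ile1 ?(ltW c0).
Qed.

(** On the constraint the l2 norm is at least 1, since
    [pow_sum x <= |x|^(2 s) * |x|^2]. *)
Lemma J_inf_ge x0 : pow_sum x0 = 1 -> w <= J_inf d s w.
Proof.
move=> a0; apply: lb_le_inf.
  by exists (J w x0), x0 => //; exact/admissibleP.
move=> _ [u [/mem_lp2P su nu] <-]; move: nu; rewrite -[u](toL2E su); set x := toL2 u => nx.
have ax : pow_sum x = 1 by apply/admissibleP; split => //; apply/mem_lp2P/l2P.
rewrite JE; apply: le_trans (Aop_ge w _); rewrite ler_peMr ?(ltW w0)//.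
rewrite leNgt; apply/negP => x1; have := pow_sum_le x; rewrite ax leNgt => /negP; apply.
have [->|xx0] := eqVneq (dot x x) 0; first by rewrite mulr0.
have xp : 0 < dot x x by rewrite lt_neqAle eq_sym xx0 dot_ge0.
have : dot x x `^ s <= 1.
  rewrite [leRHS](_ : 1 = 1 `^ s); last by rewrite powR1.
  apply: ge0_ler_powR; rewrite ?nnegrE ?(ltW s0) ?dot_ge0//.
  exact: ltW.
nra.
Qed.

Lemma right_derivative_ge0 (b c : R) :
  (forall t, 0 < t -> 0 <= 2 * t * b + t ^+ 2 * c) -> 0 <= b.
Proof.
move=> q; rewrite leNgt; apply/negP => b0.
have c1 : 0 < `|c| + 1 by have := normr_ge0 c; lra.
have t0 : 0 < - b / (`|c| + 1) by rewrite divr_gt0//; lra.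
have := q _ t0; set t := - b / _ in t0 *.
have tE : t * (`|c| + 1) = - b by rewrite /t divfK// gt_eqF.
have := ler_norm c; nra.
Qed.

Section AtMinimizer.
Variable x : H.
Hypotheses (x_ge0 : forall n, 0 <= x n) (x_adm : pow_sum x = 1).
Hypothesis x_min : dot (Aop w x) x = J_inf d s w.

Let A := Aop w : H -> H.

(** Where [x] vanishes, raising that coordinate does not decrease the constraint,
    hence not the energy, so [A x >= 0] there; but [A x] is minus the sum over
    the neighbours, which must therefore vanish too. *)
Lemma minimizer_gt0 n : 0 < x n.
Proof.
have zero_spreads m : x m = 0 -> forall e, x (m + step e) = 0.
  move=> xm; have Am : 0 <= A x m.
    apply: (@right_derivative_ge0 _ (dot (A (delta_l2 R m)) (delta_l2 R m))) => t t0.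
    have : J_inf d s w <= dot (A (x + t *: delta_l2 R m)) (x + t *: delta_l2 R m).
      apply: J_inf_le_of_ge1; rewrite -x_adm !pow_sum_tsum.
      apply: le_tsum; [exact: summ_pow|exact: summ_pow|move=> k].
      rewrite l2D l2Z delta_l2E; have [->|_] := eqVneq k m; last by rewrite mulr0 addr0.
      by rewrite xm normr0 powR0 ?powR_ge0.
    rewrite (sym_quadD _ _ _ (Aop_sym w)) -/A dot_delta.
    rewrite -x_min -/A; lra.
  move: Am; rewrite /A AopE laplacianE xm mul0rn subr0 mulr0 addr0 oppr_ge0 => Am.
  have : \sum_e x (m + step e) == 0 by rewrite eq_le Am sumr_ge0.
  rewrite psumr_eq0// => /allP z e.
  by have := z e; rewrite mem_index_enum => /(_ isT)/eqP.
rewrite lt_neqAle x_ge0 andbT; apply/negP => /eqP xn.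
have x_zero m : x m = 0.
  apply: (@lattice_connected d (fun k => x k = 0) n) => // k e xk.
  exact: zero_spreads.
have : pow_sum x = 0.
  by rewrite /pow_sum /psum esum1// => m _; rewrite x_zero normr0 powR0.
by rewrite x_adm => /eqP; rewrite oner_eq0.
Qed.

(* The curve [x (1 + t b)^(1/p)] preserves the constraint exactly, because its
   p-th power is affine in [t] and [y] is tangent.  The choice [b = p y / x]
   makes its velocity at [t = 0] equal to [y]. *)
Section Path.
Variables (y : H) (supp : seq L).
Hypotheses (supp_uniq : uniq supp) (y_supp : forall n, n \notin supp -> y n = 0).
Hypothesis y_tangent : \sum_(n <- supp) x n `^ (p - 1) * y n = 0.

Let b n := p * y n / x n.

Definition path_quotient t : H :=
  toL2 (fun n => x n * (((1 + t * b n) `^ p^-1 - 1) / t)).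

Let b_out n : n \notin supp -> b n = 0.
Proof. by move=> /y_supp yn; rewrite /b yn mulr0 mul0r. Qed.

Let D_out0 t n : n \notin supp -> x n * (((1 + t * b n) `^ p^-1 - 1) / t) = 0.
Proof. by move=> /b_out ->; rewrite mulr0 addr0 powR1 subrr mul0r mulr0. Qed.

Lemma path_quotientE t n :
  path_quotient t n = x n * (((1 + t * b n) `^ p^-1 - 1) / t).
Proof.
by rewrite /path_quotient toL2E//; apply: (fin_sqsumm supp_uniq); exact: D_out0.
Qed.

Let D_out t n : n \notin supp -> path_quotient t n = 0.
Proof. by move=> ns; rewrite path_quotientE D_out0. Qed.

Lemma path_admissible t : 0 < t -> (forall n, 0 <= 1 + t * b n) ->
  pow_sum (x + t *: path_quotient t) = 1.
Proof.
move=> t0 tb; rewrite pow_sum_tsum.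
have e n : `|(x + t *: path_quotient t) n| `^ p = `|x n| `^ p + t * p * (x n `^ (p - 1) * y n).
  have xn := minimizer_gt0 n.
  have -> : (x + t *: path_quotient t) n = x n * (1 + t * b n) `^ p^-1.
    rewrite l2D l2Z path_quotientE; field; exact: lt0r_neq0.
  rewrite ger0_norm ?mulr_ge0 ?powR_ge0// powRM ?powR_ge0// -powRrM mulVf// powRr1//.
  rewrite (ger0_norm (ltW xn)) -(mulr_powRB1 (ltW xn) p_gt0) /b; field; exact: lt0r_neq0.
have st : summ (fun n => x n `^ (p - 1) * y n) /\
    tsum (fun n => x n `^ (p - 1) * y n) = 0.
  by rewrite -y_tangent; apply: tsum_fin => // n /y_supp ->; rewrite mulr0.
rewrite (eq_tsum e) tsumD ?tsumZ ?st.2 ?mulr0 ?addr0; first by rewrite -pow_sum_tsum.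
- exact: st.1.
- exact: summ_pow.
- exact/summZ/st.1.
Qed.

Let t k : R := harmonic k.
Let t_gt0 k : 0 < t k. Proof. exact: harmonic_gt0. Qed.
Let t_cvg : t k @[k --> \oo] --> (0 : R). Proof. exact: cvg_harmonic. Qed.

Lemma path_energy : \forall k \near \oo,
  0 <= 2 * dot (A x) (path_quotient (t k)) +
    t k * dot (A (path_quotient (t k))) (path_quotient (t k)).
Proof.
pose B := \sum_(n <- supp) `|b n|.
have bB n : `|b n| <= B.
  have [ns|/b_out ->] := boolP (n \in supp); last by rewrite normr0 sumr_ge0.
  by rewrite /B (perm_big _ (perm_to_rem ns)) big_cons lerDl sumr_ge0.
have B0 : 0 <= B by apply: sumr_ge0.
have B1 : 0 < (B + 1)^-1 by rewrite invr_gt0; lra.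
apply: filterS (cvg0_lt t_cvg B1) => k.
rewrite ger0_norm ?(ltW (t_gt0 k))// => tk.
have tB : t k * (B + 1) < 1 by rewrite -ltr_pdivlMr ?mul1r//; lra.
have tb n : 0 <= 1 + t k * b n.
  have := bB n; rewrite ler_norml => /andP[h _]; have := t_gt0 k; nra.
have := J_inf_le (path_admissible (t_gt0 k) tb).
rewrite (sym_quadD _ _ _ (Aop_sym w)) -/A -x_min => h.
rewrite -(pmulr_rge0 _ (t_gt0 k)); move: h; rewrite -/A; lra.
Qed.

Lemma second_quotient_cvg n :
  ((1 + t k * b n) `^ p^-1 - 1 - p^-1 * (t k * b n)) / t k ^+ 2 @[k --> \oo] -->
  p^-1 * (p^-1 - 1) / 2 * b n ^+ 2.
Proof.
have [b0|b0] := eqVneq (b n) 0.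
  rewrite b0 expr0n mulr0; apply: (cvg_eq (f := fun=> 0)); last exact: cvg_cst.
  by move=> k; rewrite !mulr0 addr0 powR1 subrr subr0 mul0r.
have h : ((1 + t k * b n) `^ p^-1 - 1 - p^-1 * (t k * b n)) / (t k * b n) ^+ 2
    @[k --> \oo] --> p^-1 * (p^-1 - 1) / 2.
  apply: (proj1 (cvgr_dnbhsP _ _ _) (@powR_second_order R p^-1) (fun k => t k * b n)).
  split=> [k|]; first by rewrite mulf_neq0// gt_eqF.
  by rewrite -[X in _ --> X](mul0r (b n)); apply: cvgM => //; exact: cvg_cst.
apply: (cvg_eq (f := fun k => ((1 + t k * b n) `^ p^-1 - 1 -
    p^-1 * (t k * b n)) / (t k * b n) ^+ 2 * b n ^+ 2)).
  by move=> k; field; rewrite b0 p_neq0 (lt0r_neq0 (t_gt0 k)).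
by apply: cvgM => //; exact: cvg_cst.
Qed.

Lemma path_quotient_cvg :
  dot (path_quotient (t k) - y) (path_quotient (t k) - y) @[k --> \oo] --> (0 : R).
Proof.
have c n : path_quotient (t k) n @[k --> \oo] --> y n.
  apply: (cvg_eq (f := fun k => x n * (((1 + t k * b n) `^ p^-1 - 1 -
      p^-1 * (t k * b n)) / t k ^+ 2 * t k + p^-1 * b n))).
    by move=> k; rewrite path_quotientE; field; rewrite p_neq0 (lt0r_neq0 (t_gt0 k)).
  rewrite -[X in _ --> X](_ : x n * (p^-1 * (p^-1 - 1) / 2 * b n ^+ 2 * 0 + p^-1 * b n) = _).
    apply: cvgM; first exact: cvg_cst.
    apply: cvgD; last exact: cvg_cst.
    by apply: cvgM => //; exact: second_quotient_cvg.
  by rewrite mulr0 add0r /b; field; rewrite p_neq0 (lt0r_neq0 (minimizer_gt0 n)).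
have e k : \sum_(n <- supp) (path_quotient (t k) n - y n) ^+ 2 =
    dot (path_quotient (t k) - y) (path_quotient (t k) - y).
  rewrite (dot_fin (path_quotient (t k) - y) supp_uniq) => [|m ms].
    by apply: eq_bigr => n _; rewrite l2B expr2.
  by rewrite l2B y_supp// D_out// subr0.
apply: cvg_eq e _.
apply: (@cvg_bigsum0 R _ eventually_filter _ supp
  (fun k n => (path_quotient (t k) n - y n) ^+ 2)) => n.
have c0 : path_quotient (t k) n - y n @[k --> \oo] --> (0 : R) by exact/subr_cvg0.
by rewrite -[X in _ --> X](mulr0 (0 : R)); apply: cvgM.
Qed.

Let A_bound : exists C : R, forall z, `|dot (A z) z| <= C * dot z z.
Proof.
exists (2 * (2 * d)%:R + w) => z; rewrite ger0_norm; first exact: Aop_le.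
by apply: le_trans (Aop_ge w _); rewrite mulr_ge0 ?(ltW w0) ?dot_ge0.
Qed.

Let A_cvg : dot (A (path_quotient (t k))) (path_quotient (t k)) @[k --> \oo] -->
  dot (A y) y.
Proof.
have [C AC] := A_bound.
exact: (strong_quad_cvg _ (Aop_sym w) AC path_quotient_cvg).
Qed.

Lemma first_variation : 0 <= dot (A x) y.
Proof.
have c : 2 * dot (A x) (path_quotient (t k)) +
    t k * dot (A (path_quotient (t k))) (path_quotient (t k)) @[k --> \oo] -->
    2 * dot (A x) y + 0 * dot (A y) y.
  apply: cvgD; last exact: cvgM.
  apply: cvgM; first exact: cvg_cst.
  rewrite (dotC (A x)); under eq_fun do rewrite (dotC (A x)).
  exact: (strong_wcvg _ path_quotient_cvg).
have : 0 <= 2 * dot (A x) y + 0 * dot (A y) y.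
  exact: (ler_cvg_to (cvg_cst (0 : R)) c path_energy).
by rewrite mul0r addr0 pmulr_rge0.
Qed.

(** By the Euler-Lagrange equation and tangency, pairing [A x] with the
    difference quotient of the curve only retains the quadratic part of the
    expansion of [(1 + t b)^(1/p)], whose coefficient [p^-1 (p^-1 - 1) / 2]
    produces the factor [p - 1]. *)
Lemma second_variation (lam : R) :
  (forall n, A x n = lam * x n `^ (p - 1)) ->
  lam * (p - 1) * \sum_(n <- supp) x n `^ (p - 2) * y n ^+ 2 <= dot (A y) y.
Proof.
move=> EL.
pose q k n := lam * x n `^ p * (((1 + t k * b n) `^ p^-1 - 1 - p^-1 * (t k * b n)) / t k ^+ 2).
have qc : \sum_(n <- supp) q k n @[k --> \oo] -->
    \sum_(n <- supp) lam * x n `^ p * (p^-1 * (p^-1 - 1) / 2 * b n ^+ 2).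
  apply: cvg_bigsum => n; apply: cvgM; first exact: cvg_cst.
  exact: second_quotient_cvg.
have qE k : dot (A x) (path_quotient (t k)) = t k * \sum_(n <- supp) q k n.
  rewrite (dot_fin (s := supp))//; last by move=> n; exact: D_out.
  transitivity (\sum_(n <- supp) (t k * q k n + lam * (x n `^ (p - 1) * y n))).
    apply: eq_bigr => n _; have xn := minimizer_gt0 n.
    rewrite EL path_quotientE /q -(mulr_powRB1 (ltW xn) p_gt0) /b.
    field; rewrite p_neq0 !gt_eqF//.
  by rewrite big_split/= -!mulr_sumr y_tangent mulr0 addr0.
have c : 2 * \sum_(n <- supp) q k n +
    dot (A (path_quotient (t k))) (path_quotient (t k)) @[k --> \oo] -->
    2 * (\sum_(n <- supp) lam * x n `^ p * (p^-1 * (p^-1 - 1) / 2 * b n ^+ 2)) + dot (A y) y.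
  by apply: cvgD => //; apply: cvgM => //; exact: cvg_cst.
have near0 : \forall k \near \oo, 0 <= 2 * \sum_(n <- supp) q k n +
    dot (A (path_quotient (t k))) (path_quotient (t k)).
  apply: filterS path_energy => k; rewrite qE => h.
  rewrite -(pmulr_rge0 _ (t_gt0 k)); move: h; lra.
have : 0 <= 2 * (\sum_(n <- supp) lam * x n `^ p * (p^-1 * (p^-1 - 1) / 2 * b n ^+ 2)) +
    dot (A y) y by exact: (ler_cvg_to (cvg_cst (0 : R)) c near0).
have -> : \sum_(n <- supp) lam * x n `^ p * (p^-1 * (p^-1 - 1) / 2 * b n ^+ 2) =
    - (2^-1 * (lam * (p - 1) * \sum_(n <- supp) x n `^ (p - 2) * y n ^+ 2)).
  rewrite !mulr_sumr -sumrN; apply: eq_bigr => n _; have xn := minimizer_gt0 n.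
  have -> : x n `^ p = x n `^ (p - 2) * x n ^+ 2.
    rewrite -powR_mulrn ?(ltW xn)// -powRD ?subrK//.
    by apply/implyP => _; rewrite gt_eqF.
  rewrite /b; field; rewrite p_neq0 gt_eqF//.
lra.
Qed.

End Path.

(** Two-point variations show that [A x] is proportional to [x^(2 s + 1)]; pairing
    with [x] identifies the factor. *)
Lemma Euler_Lagrange n : A x n = J_inf d s w * x n `^ (2 * s + 1).
Proof.
have p1 : p - 1 = 2 * s + 1 by rewrite /p; ring.
rewrite -p1.
have prop m : x m `^ (p - 1) * A x n = x n `^ (p - 1) * A x m.
  have [->|nm] := eqVneq n m; first by [].
  pose y := x m `^ (p - 1) *: delta_l2 R n - x n `^ (p - 1) *: delta_l2 R m.
  have us : uniq [:: n; m] by rewrite /= inE nm.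
  have yE k : y k = x m `^ (p - 1) * (k == n)%:R - x n `^ (p - 1) * (k == m)%:R.
    by rewrite -!delta_l2E.
  have ys k : k \notin [:: n; m] -> y k = 0.
    by rewrite !inE negb_or yE => /andP[/negbTE -> /negbTE ->]; rewrite !mulr0 subr0.
  have y0 : \sum_(k <- [:: n; m]) x k `^ (p - 1) * y k = 0.
    by rewrite big_cons big_seq1 !yE !eqxx (negbTE nm) (eq_sym m) (negbTE nm) /=
      !mulr1 !mulr0 subr0 sub0r mulrN mulrC subrr.
  have y0N : \sum_(k <- [:: n; m]) x k `^ (p - 1) * (- y) k = 0.
    rewrite (eq_bigr (fun k => - (x k `^ (p - 1) * y k))) ?sumrN ?y0 ?oppr0//.
    by move=> k _; rewrite l2N mulrN.
  have ysN k : k \notin [:: n; m] -> (- y) k = 0 by move=> /ys h; rewrite l2N h oppr0.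
  have yA z : dot z y = x m `^ (p - 1) * z n - x n `^ (p - 1) * z m.
    by rewrite /y dotBr !dotZr !dot_delta.
  have := first_variation us ys y0; have := first_variation us ysN y0N.
  rewrite dotNr yA; move: (x m `^ _ * _) (x n `^ _ * _) => a b h1 h2; lra.
have x0 := minimizer_gt0 0.
have AE m : A x m = A x n / x n `^ (p - 1) * x m `^ (p - 1).
  have := prop m; have := powR_gt0 (p - 1) (minimizer_gt0 n) => h e.
  by apply: (mulfI (lt0r_neq0 h)); rewrite -e; field; exact: lt0r_neq0.
have : dot (A x) x = A x n / x n `^ (p - 1).
  rewrite /dot (eq_tsum (g := fun m => A x n / x n `^ (p - 1) * `|x m| `^ p)).
    rewrite tsumZ; last exact: summ_pow.
    by rewrite -pow_sum_tsum x_adm mulr1.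
  move=> m; rewrite AE -mulrA; congr (_ * _).
  by rewrite (ger0_norm (x_ge0 m)) -(mulr_powRB1 (x_ge0 m) p_gt0) mulrC.
by rewrite x_min => ->; rewrite divfK// lt0r_neq0// powR_gt0// minimizer_gt0.
Qed.

End AtMinimizer.
End Minimizer.

(** * Uniform continuity of powers *)

Section PowerContinuity.
Variable R : realType.
Implicit Types (a b c q M e : R).

Lemma powR_MVT_lt q a b : 0 < b -> b < a ->
  exists c, [/\ b < c, c < a & a `^ q - b `^ q = q * c `^ (q - 1) * (a - b)].
Proof.
move=> b0 ba; have [||c] := @MVT R (fun z => z `^ q) (fun z => q * z `^ (q - 1)) b a ba.
- by move=> z; rewrite in_itv/= => /andP[bz _]; apply: is_derive1_powR; exact: lt_trans bz.
- apply: derivable_within_continuous => z; rewrite in_itv/= => /andP[bz _].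
  by apply: derivable_powR; rewrite in_itv/= andbT; exact: lt_le_trans bz.
by rewrite in_itv/= => /andP[bc ca] ->; exists c.
Qed.

Lemma powR_MVT q a b : 0 < a -> 0 < b ->
  exists c, [/\ 0 < c, `|c - b| <= `|a - b| &
    a `^ q - b `^ q = q * c `^ (q - 1) * (a - b)].
Proof.
move=> a0 b0; have [ab|ba|->] := ltgtP a b.
- have [c [ac cb e]] := powR_MVT_lt q a0 ab; exists c; split.
  + exact: lt_trans ac.
  + by rewrite !ltr0_norm ?subr_lt0//; lra.
  + by rewrite -opprB e; ring.
- have [c [bc ca e]] := powR_MVT_lt q b0 ba; exists c; split => //.
  + exact: lt_trans bc.
  + by rewrite !gtr0_norm ?subr_gt0//; lra.
- by exists b; split=> //; rewrite !subrr mulr0.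
Qed.

(** Near 0 both powers are small; away from 0 the mean value theorem applies, and
    [c^(q-1) = c^q / c] bounds the derivative for every [q]. *)
Lemma powR_uniform q M e : 0 < q -> 0 < e -> exists2 eta, 0 < eta &
  forall a b, 0 <= a -> 0 <= b <= M -> `|a - b| <= eta -> `|a `^ q - b `^ q| <= e.
Proof.
move=> q0 e0; pose h := e `^ q^-1 / 2.
have h0 : 0 < h by rewrite divr_gt0 ?powR_gt0.
have h2 : (2 * h) `^ q = e.
  by rewrite /h mulrCA mulfV ?mulr1// -powRrM mulVf ?gt_eqF// powRr1 ?ltW.
pose K := q * (`|M| + h) `^ q / h.
have K0 : 0 < K by rewrite divr_gt0// mulr_gt0// powR_gt0; have := normr_ge0 M; lra.
pose eta := Num.min h (e / K).
have eta0 : 0 < eta by rewrite lt_min h0 divr_gt0.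
suff key a b : 0 <= b -> b <= a -> a <= `|M| + h -> a - b <= eta -> a `^ q - b `^ q <= e.
  exists eta => // a b a0 /andP[b0 bM] ab.
  have MM : M <= `|M| by exact: ler_norm.
  have [ba|ab'] := leP b a.
    rewrite ger0_norm ?subr_ge0 in ab => //.
    have ah : a - b <= h by apply: le_trans ab _; rewrite ge_min lexx.
    rewrite ger0_norm; first by apply: key => //; lra.
    by rewrite subr_ge0; apply: ge0_ler_powR; rewrite ?nnegrE ?(ltW q0).
  rewrite distrC ger0_norm ?subr_ge0 ?(ltW ab')// in ab.
  rewrite distrC ger0_norm; first by apply: key => //; [exact: ltW|lra].
  by rewrite subr_ge0; apply: ge0_ler_powR; rewrite ?nnegrE ?(ltW q0) ?(ltW ab').
move=> b0 ba aM ab.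
have abh : a - b <= h by apply: le_trans ab _; rewrite ge_min lexx.
have [bh|bh] := leP b h.
  apply: (@le_trans _ _ (a `^ q)); first by rewrite gerBl powR_ge0.
  rewrite -h2; apply: ge0_ler_powR; rewrite ?nnegrE ?(ltW q0)//; lra.
have [->|ba'] := eqVneq a b; first by rewrite subrr ltW.
have {}ba : b < a by rewrite lt_neqAle eq_sym ba'.
have bp : 0 < b by lra.
have [c [bc ca ->]] := powR_MVT_lt q bp ba.
have c0 : 0 < c by lra.
have cq : c `^ (q - 1) <= (`|M| + h) `^ q / h.
  rewrite ler_pdivlMr//; apply: (@le_trans _ _ (c * c `^ (q - 1))).
    by rewrite mulrC ler_wpM2r ?powR_ge0//; lra.
  rewrite mulr_powRB1 ?(ltW c0)//; apply: ge0_ler_powR; rewrite ?nnegrE ?(ltW q0) ?(ltW c0)//; lra.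
apply: (@le_trans _ _ (K * eta)).
  apply: ler_pM => //.
  - by rewrite mulr_ge0 ?powR_ge0 ?(ltW q0).
  - by rewrite subr_ge0 ltW.
  - by rewrite /K -mulrA ler_wpM2l// ltW.
by rewrite -ler_pdivlMl// mulrC ge_min lexx orbT.
Qed.

Lemma cvg_powR (F : set_system nat) (FF : ProperFilter F) (f : nat -> R) q l : 0 < q ->
  (forall k, 0 <= f k) -> f k @[k --> F] --> l -> f k `^ q @[k --> F] --> l `^ q.
Proof.
move=> q0 f0 fl; have l0 : 0 <= l by exact: (limit_ge fl f0).
apply/cvgrPdist_lt => e e0; have e2 : 0 < e / 2 by rewrite divr_gt0.
have [eta eta0 h] := powR_uniform l q0 e2.
have fl0 : (f k - l) @[k --> F] --> (0 : R) by exact/subr_cvg0.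
apply: filterS (cvg0_lt fl0 eta0) => k fk.
rewrite distrC; apply: le_lt_trans (h (f k) l (f0 k) _ (ltW fk)) _; last by lra.
by rewrite l0 lexx.
Qed.

End PowerContinuity.

(** * The wave of a minimizer *)

Section MinimizerWave.
Variables (R : realType) (d : nat) (s w : R).
Local Notation L := (lattice d).
Local Notation H := (l2 R L).
Hypotheses (s0 : 0 < s) (w0 : 0 < w).
Implicit Types (x y h : H).

Let s2_gt0 : 0 < 2 * s. Proof. by have := s0; lra. Qed.

Definition wave_factor (w' : R) := J_inf d s w' `^ (2 * s)^-1.

Lemma wave_equation w' x n : 0 < J_inf d s w' -> 0 <= x n ->
  Aop w' x n = J_inf d s w' * x n `^ (2 * s + 1) ->
  Aop w' (wave_factor w' *: x) n = (wave_factor w' *: x) n `^ (2 * s + 1).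
Proof.
move=> j0 x0 e; rewrite (symZ _ _ (Aop_sym w')) !l2Z e powRM ?powR_ge0// mulrA; congr (_ * _).
rewrite powRD ?powRr1 ?powR_ge0//; last first.
  by apply/implyP => _; apply: lt0r_neq0; exact: powR_gt0.
by rewrite /wave_factor -powRrM mulVf ?gt_eqF// powRr1 ?(ltW j0)// mulrC.
Qed.

Lemma square_summable_vanishing x : vanishing x.
Proof.
move=> e e0; have sx : summ (fun n => x n ^+ 2) by exact/sqsummP/l2P.
have e2 : 0 < e ^+ 2 by rewrite exprn_gt0.
have [S uS xS] := tail_small (fun n => sqr_ge0 (x n)) sx e2; exists S => // n nS.
rewrite -(@ltr_pXn2r _ 2)// ?nnegrE ?(ltW e0)// real_normK ?num_real//.
apply: le_lt_trans xS.
have g0 m : 0 <= (if m \in S then 0 else x m ^+ 2) by case: ifP => // _; exact: sqr_ge0.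
have sg : summ (fun m => if m \in S then 0 else x m ^+ 2).
  by apply: summ_le sx => m; case: ifP; rewrite ?normr0.
by have := @psum_ge_fin _ _ _ [:: n] g0 sg isT; rewrite big_seq1 (negbTE nS).
Qed.

(** The multiplications subtracted from [- Delta + w] in [L-] and in [L+]. *)
Definition potential x (n : L) : R := x n `^ (2 * s).
Definition potential_plus x (n : L) : R := (2 * s + 1) * potential x n.

Lemma potential_vanishing x : (forall n, 0 <= x n) -> vanishing (potential x).
Proof.
move=> x0 e e0.
have h0 : 0 < e `^ (2 * s)^-1 by rewrite powR_gt0.
have [S uS xS] := square_summable_vanishing x h0; exists S => // n /xS.
rewrite (ger0_norm (x0 n)) ger0_norm ?powR_ge0// => xn.
have -> : e = (e `^ (2 * s)^-1) `^ (2 * s).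
  by rewrite -powRrM mulVf ?gt_eqF// powRr1// ltW.
by apply: gt0_ltr_powR; rewrite ?nnegrE ?(ltW h0).
Qed.

Lemma potential_plus_vanishing x : (forall n, 0 <= x n) ->
  vanishing (potential_plus x).
Proof.
move=> x0 e e0; have c0 : 0 < 2 * s + 1 by have := s0; lra.
have ec : 0 < e / (2 * s + 1) by rewrite divr_gt0.
have [S uS xS] := potential_vanishing x0 ec; exists S => // n /xS.
by rewrite /potential_plus normrM (gtr0_norm c0) ltr_pdivlMr// mulrC.
Qed.

Section Index.
Variable x : H.
Hypotheses (x_ge0 : forall n, 0 <= x n) (x_adm : pow_sum s x = 1).
Hypothesis x_min : dot (Aop w x) x = J_inf d s w.

Let phi := wave_factor w *: x.

Let j_gt0 : 0 < J_inf d s w.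
Proof. exact: lt_le_trans (J_inf_ge s0 w0 x_adm). Qed.

Let c_gt0 : 0 < wave_factor w. Proof. exact: powR_gt0. Qed.

Let x_gt0 n : 0 < x n. Proof. exact: (minimizer_gt0 s0 w0 x_ge0 x_adm x_min). Qed.

Lemma minimizer_wave_gt0 n : 0 < phi n.
Proof. by rewrite l2Z mulr_gt0. Qed.

Let phi_ge0 n : 0 <= phi n. Proof. exact/ltW/minimizer_wave_gt0. Qed.

Lemma minimizer_wave_equation n : Aop w phi n = phi n `^ (2 * s + 1).
Proof. by apply: wave_equation => //; exact: (Euler_Lagrange s0 w0 x_ge0 x_adm x_min). Qed.

Let psi := mulL2 (potential phi) phi.

Let phi_pot n : potential phi n = J_inf d s w * x n `^ (2 * s).
Proof.
rewrite /potential l2Z powRM ?(ltW (x_gt0 n)) ?(ltW c_gt0)// /wave_factor.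
by rewrite -powRrM mulVf ?gt_eqF// powRr1// ltW.
Qed.

Let psiE n : psi n = J_inf d s w * wave_factor w * x n `^ (2 * s + 2 - 1).
Proof.
rewrite /psi mulL2E; last exact: potential_vanishing.
have -> : 2 * s + 2 - 1 = 2 * s + 1 by ring.
rewrite phi_pot l2Z powRD; last by apply/implyP => _; exact: lt0r_neq0.
by rewrite powRr1 ?(ltW (x_gt0 n)); ring.
Qed.

Let index_fin (y : H) (S : seq L) : uniq S -> (forall n, n \notin S -> y n = 0) ->
  dot y psi = 0 -> 0 <= dot (Lop w (potential_plus phi) y) y.
Proof.
move=> uS yS y0.
have tan : \sum_(n <- S) x n `^ (2 * s + 2 - 1) * y n = 0.
  move: y0; rewrite dotC (dot_fin _ uS yS).
  under eq_bigr do rewrite psiE -mulrA.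
  rewrite -mulr_sumr => /eqP; rewrite mulf_eq0 => /orP[|/eqP//].
  by rewrite gt_eqF// mulr_gt0.
have EL n : Aop w x n = J_inf d s w * x n `^ (2 * s + 2 - 1).
  have -> : 2 * s + 2 - 1 = 2 * s + 1 by ring.
  exact: (Euler_Lagrange s0 w0 x_ge0 x_adm x_min).
rewrite /Lop dotBl subr_ge0.
apply: le_trans (second_variation s0 w0 x_ge0 x_adm x_min uS yS tan EL).
rewrite (dot_fin _ uS yS) mulr_sumr; apply: ler_sum => n _.
rewrite mulL2E; last exact: potential_plus_vanishing.
rewrite /potential_plus phi_pot.
have -> : 2 * s + 2 - 2 = 2 * s by ring.
by rewrite le_eqVlt; apply/orP; left; apply/eqP; ring.
Qed.

(** The second variation gives this for finitely supported [h].  In general cut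
    [h] off to finite sets and restore orthogonality to [psi] by correcting the
    value at the origin. *)
Lemma minimizer_wave_index h : dot h psi = 0 ->
  0 <= dot (Lop w (potential_plus phi) h) h.
Proof.
move=> h0; have sh : summ (fun n => h n ^+ 2) by exact/sqsummP/l2P.
have /choice[S SP] : forall k, exists S, uniq S /\
    psum (fun n => if n \in S then 0 else h n ^+ 2) < harmonic k.
  move=> k; have [S uS hS] := tail_small (fun n => sqr_ge0 (h n)) sh (@harmonic_gt0 R k).
  by exists S.
pose hk k : H := toL2 (fun n => if n \in S k then h n else 0).
have hkE k n : hk k n = if n \in S k then h n else 0.
  by rewrite /hk toL2E//; apply: sqsumm_le (l2P h) => m; case: ifP; rewrite ?normr0.
have hk_cvg : dot (hk k - h) (hk k - h) @[k --> \oo] --> (0 : R).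
  apply: (@cvg0_le _ _ _ _ harmonic) => [k|]; last exact: cvg_harmonic.
  rewrite ger0_norm ?dot_ge0//.
  apply: le_trans (ltW (SP k).2); rewrite /dot tsum_psum.
  - rewrite le_eqVlt; apply/orP; left; apply/eqP; congr psum; apply/funext => n.
    by rewrite l2B hkE; case: ifP; rewrite ?subrr ?mulr0// sub0r mulrNN expr2.
  - by move=> n; rewrite -expr2 sqr_ge0.
  - exact: summM (l2P _) (l2P _).
have psi0 : 0 < psi 0 by rewrite psiE !mulr_gt0// powR_gt0.
pose ck k := dot (hk k) psi / psi 0.
have ck_cvg : ck k @[k --> \oo] --> (0 : R).
  rewrite -[X in _ --> X](mul0r (psi 0)^-1) -h0; apply: cvgM; last exact: cvg_cst.
  exact: (strong_wcvg _ hk_cvg).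
pose y k := hk k - ck k *: delta_l2 R (0 : L).
have y_cvg : dot (y k - h) (y k - h) @[k --> \oo] --> (0 : R).
  apply: (@cvg0_le _ _ _ _ (fun k => 2 * dot (hk k - h) (hk k - h) + 2 * ck k * ck k)).
    move=> k; rewrite ger0_norm ?dot_ge0//.
    have -> : y k - h = (hk k - h) + - (ck k *: delta_l2 R 0) by rewrite /y addrAC.
    apply: le_trans (dotD_le _ _) _.
    rewrite [dot (- _) _]dotNl [dot _ (- _)]dotNr opprK dotZl dotZr dot_delta delta_l2E eqxx mulr1.
    by rewrite mulrA.
  rewrite -[X in _ --> X](_ : 2 * 0 + 2 * 0 * 0 = 0); last by rewrite !mulr0 addr0.
  apply: cvgD; apply: cvgM => //; [exact: cvg_cst|].
  by apply: cvgM => //; exact: cvg_cst.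
have vV := potential_plus_vanishing phi_ge0.
have [C _ LC] := Lop_bound w0 vV.
have c := strong_quad_cvg eventually_filter (Lop_sym w vV) LC y_cvg.
apply: (@limit_ge _ _ eventually_filter _ _ _ c) => k.
apply: (@index_fin _ (undup (0 :: S k))); first exact: undup_uniq.
  move=> n; rewrite mem_undup inE negb_or => /andP[n0 nS].
  by rewrite l2B l2Z hkE (negbTE nS) delta_l2E (negbTE n0) mulr0 subr0.
have ckE : ck k * psi 0 = dot (hk k) psi by rewrite /ck divfK// lt0r_neq0.
by rewrite /y dotBl dotZl (dotC (delta_l2 R 0)) dot_delta ckE subrr.
Qed.

End Index.
End MinimizerWave.

(** * The limit wave and the slope of the squared norm *)

Section LimitWave.
Variables (R : realType) (d : nat) (s w : R).
Local Notation L := (lattice d).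
Local Notation H := (l2 R L).
Variables (delta : nat -> R) (xs : nat -> H) (x : H).
Hypotheses (s0 : 0 < s) (w0 : 0 < w).
Hypotheses (delta_neq0 : forall k, delta k != 0)
  (delta_cvg : delta k @[k --> \oo] --> (0 : R))
  (w_delta : forall k, 0 < w + delta k).
Hypotheses (xs_ge0 : forall k n, 0 <= xs k n)
  (xs_adm : forall k, pow_sum s (xs k) = 1)
  (xs_min : forall k, dot (Aop (w + delta k) (xs k)) (xs k) = J_inf d s (w + delta k)).
Hypothesis xs_cvg : dot (xs k - x) (xs k - x) @[k --> \oo] --> (0 : R).

Let j k := J_inf d s (w + delta k).

Lemma strong_norm_cvg (r : nat -> H) z :
  dot (r k - z) (r k - z) @[k --> \oo] --> (0 : R) ->
  dot (r k) (r k) @[k --> \oo] --> dot z z.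
Proof.
move=> rz; apply: (strong_quad_cvg (A := id) (C := 1) _ _ _ rz) => // y.
by rewrite ger0_norm ?dot_ge0// mul1r.
Qed.

Lemma Aop_addw a b (z : H) : Aop (a + b) z = Aop a z + b *: z.
Proof. by rewrite /Aop addrAC [in LHS]scalerDl addrAC. Qed.

Let energy k (z : H) : dot (Aop (w + delta k) z) z = dot (Aop w z) z + delta k * dot z z.
Proof. by rewrite Aop_addw dotDl dotZl. Qed.

Let delta_norm_cvg : delta k * dot (xs k) (xs k) @[k --> \oo] --> (0 : R).
Proof.
rewrite -[X in _ --> X](mul0r (dot x x)); apply: cvgM => //.
exact: strong_norm_cvg.
Qed.

(** The energies at [w] and at [w + delta k] differ by [delta k] times a squared
    l2 norm.  Test the problem at [w] with the minimizers at [w + delta k], and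
    the problem at [w + delta k] with a fixed almost minimizer at [w]. *)
Lemma J_inf_cvg : j k @[k --> \oo] --> J_inf d s w.
Proof.
apply/cvgrPdist_lt => e e0; have e2 : 0 < e / 2 by rewrite divr_gt0.
have low k : J_inf d s w <= j k - delta k * dot (xs k) (xs k).
  by rewrite /j -xs_min energy addrK; apply: J_inf_le.
have [v v1 vJ] : exists2 v : H, pow_sum s v = 1 & dot (Aop w v) v < J_inf d s w + e / 2.
  have iV : has_inf [set J w u | u in admissible s (d := d)].
    split; first by exists (J w (xs 0)), (xs 0) => //; exact/admissibleP.
    exists 0 => _ [u [/mem_lp2P su _] <-]; rewrite -[u](toL2E su) JE.
    by apply: le_trans (Aop_ge w _); rewrite mulr_ge0 ?(ltW w0) ?dot_ge0.
  have [_ [u [su nu] <-] uJ] := inf_adherent e2 iV.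
  have su' : u \in @sqsumm R L by exact/mem_lp2P.
  exists (toL2 u); last by rewrite -JE toL2E.
  by apply/(admissibleP s0); rewrite toL2E.
have up k : j k <= dot (Aop w v) v + delta k * dot v v.
  by rewrite -energy; apply: (J_inf_le s0 (w_delta k)).
have dv : delta k * dot v v @[k --> \oo] --> (0 : R).
  by rewrite -[X in _ --> X](mul0r (dot v v)); apply: cvgM => //; exact: cvg_cst.
near=> k.
have k1 : `|delta k * dot v v| < e / 2 by near: k; exact: cvg0_lt.
have k2 : `|delta k * dot (xs k) (xs k)| < e / 2 by near: k; exact: cvg0_lt.
have := low k; have := up k; move: k1 k2; rewrite !ltr_norml => /andP[? ?] /andP[? ?] ? ?.
by apply/andP; split; lra.
Unshelve. all: end_near. Qed.

Lemma limit_ge0 n : 0 <= x n.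
Proof.
have c := wcvg_coord (n := n) (strong_wcvg eventually_filter xs_cvg).
exact: (@limit_ge _ _ eventually_filter _ _ _ c).
Qed.

Let j_gt0 : 0 < J_inf d s w.
Proof. exact: lt_le_trans (J_inf_ge s0 w0 (xs_adm 0)). Qed.

Let limit_EL n : Aop w x n = J_inf d s w * x n `^ (2 * s + 1).
Proof.
have coord := wcvg_coord (n := n) (strong_wcvg eventually_filter xs_cvg).
have c1 : j k * xs k n `^ (2 * s + 1) @[k --> \oo] -->
    J_inf d s w * x n `^ (2 * s + 1).
  apply: cvgM; first exact: J_inf_cvg.
  apply: cvg_powR => //; have := s0; lra.
have c2 : Aop w (xs k) n + delta k * xs k n @[k --> \oo] --> Aop w x n + 0 * x n.
  apply: cvgD; last exact: cvgM.
  exact: (wcvg_coord (n := n) (sym_wcvg (Aop_sym w) (strong_wcvg eventually_filter xs_cvg))).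
rewrite mul0r addr0 in c2; apply: (cvg_unique _ c2) => //.
apply: cvg_eq c1 => k; rewrite -(Euler_Lagrange s0 (w_delta k) (xs_ge0 k) (xs_adm k) (xs_min k)).
by rewrite Aop_addw l2D l2Z.
Qed.

Lemma limit_energy : dot (Aop w x) x = J_inf d s w.
Proof.
have [C _ AC] := Aop_bound d (ltW w0).
have c1 := strong_quad_cvg eventually_filter (Aop_sym w) AC xs_cvg.
have c2 : j k - delta k * dot (xs k) (xs k) @[k --> \oo] --> J_inf d s w - 0.
  by apply: cvgB => //; exact: J_inf_cvg.
rewrite subr0 in c2; apply: (cvg_unique _ c1) => //; apply: cvg_eq c2 => k.
by rewrite /j -xs_min energy addrK.
Qed.

(** Pairing the limit of the Euler-Lagrange equations with [x] gives
    [<A x, x> = J_inf * pow_sum x], and [limit_energy] says that the left-hand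
    side is [J_inf]. *)
Lemma limit_admissible : pow_sum s x = 1.
Proof.
have p0 : 0 < 2 * s + 2 by have := s0; lra.
apply: (mulfI (lt0r_neq0 j_gt0)); rewrite mulr1 -{2}limit_energy.
rewrite (pow_sum_tsum s0) -tsumZ; last exact: summ_pow.
apply: eq_tsum => n; rewrite limit_EL (ger0_norm (limit_ge0 n)).
rewrite -(mulr_powRB1 (limit_ge0 n) p0) -mulrA; congr (_ * _).
by rewrite mulrC; congr (_ `^ _ * _); ring.
Qed.

Let phi := wave_factor d s w *: x.
Let phis k := wave_factor d s (w + delta k) *: xs k.

Let phi_gt0 n : 0 < phi n.
Proof. exact: (minimizer_wave_gt0 s0 w0 limit_ge0 limit_admissible limit_energy). Qed.

Let phi_ge0 n : 0 <= phi n. Proof. exact: ltW. Qed.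

Let phis_gt0 k n : 0 < phis k n.
Proof. exact: (minimizer_wave_gt0 s0 (w_delta k) (xs_ge0 k) (xs_adm k) (xs_min k)). Qed.

Let phi_eq n : Aop w phi n = phi n `^ (2 * s + 1).
Proof. exact: (minimizer_wave_equation s0 w0 limit_ge0 limit_admissible limit_energy). Qed.

Let phis_eq k n : Aop w (phis k) n = phis k n `^ (2 * s + 1) - delta k * phis k n.
Proof.
have := minimizer_wave_equation s0 (w_delta k) (xs_ge0 k) (xs_adm k) (xs_min k) n.
by rewrite -/(phis k) Aop_addw l2D l2Z => <-; rewrite addrK.
Qed.

Let phis_cvg : dot (phis k - phi) (phis k - phi) @[k --> \oo] --> (0 : R).
Proof.
pose c k := wave_factor d s (w + delta k); pose c0 := wave_factor d s w.
have cc : c k @[k --> \oo] --> c0.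
  apply: cvg_powR; [by rewrite invr_gt0; have := s0; lra| |exact: J_inf_cvg].
  by move=> k; apply: le_trans (ltW (w_delta k)) (J_inf_ge s0 (w_delta k) (xs_adm k)).
apply: (@cvg0_le _ _ _ _ (fun k => 2 * (c k * c k * dot (xs k - x) (xs k - x)) +
    2 * ((c k - c0) * (c k - c0) * dot x x))).
  move=> k; rewrite ger0_norm ?dot_ge0//.
  have -> : phis k - phi = c k *: (xs k - x) + (c k - c0) *: x.
    by rewrite scalerBr scalerBl addrA subrK.
  apply: le_trans (dotD_le _ _) _; rewrite !dotZl !dotZr !mulrA; exact: lexx.
have cc0 : c k - c0 @[k --> \oo] --> (0 : R) by exact/subr_cvg0.
rewrite -[X in _ --> X](_ : 2 * (c0 * c0 * 0) + 2 * (0 * 0 * dot x x) = 0); last by ring.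
apply: cvgD; apply: cvgM; try exact: cvg_cst.
  by apply: cvgM => //; apply: cvgM.
by apply: cvgM; [apply: cvgM|exact: cvg_cst].
Qed.

Let Vp := potential_plus s phi.
Let vVp : vanishing Vp. Proof. exact: potential_plus_vanishing. Qed.
Let Lp := Lop w Vp : H -> H.

Let rem k := Lp (phis k - phi) + delta k *: phis k.

Let remE k n : rem k n = phis k n `^ (2 * s + 1) - phi n `^ (2 * s + 1) -
  (2 * s + 1) * phi n `^ (2 * s) * (phis k n - phi n).
Proof.
have LE z : Lp z n = Aop w z n - Vp n * z n by rewrite /Lp /Lop l2B mulL2E.
have LB : Lp (phis k - phi) = Lp (phis k) - Lp phi by exact: symB (Lop_sym w vVp).
rewrite /rem LB l2D l2Z l2B !LE.
have -> : Vp n = (2 * s + 1) * phi n `^ (2 * s) by [].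
rewrite phi_eq phis_eq.
move: (phi n) (phis k n) (phi n `^ (2 * s)) (phi n `^ (2 * s + 1)) (phis k n `^ _).
by move=> a b c u v; ring.
Qed.

(* The remainder is [o(|phis k - phi|)] in l2: pointwise it is the increment
   [phis k - phi] times a difference of derivatives of the power, and the latter
   is uniformly small because the l2 norm dominates the supremum. *)
Let rem_small (e : R) : 0 < e -> \forall k \near \oo,
  dot (rem k) (rem k) <= e ^+ 2 * dot (phis k - phi) (phis k - phi).
Proof.
move=> e0; have q0 : 0 < 2 * s + 1 by have := s0; lra.
have q1 : 0 < 2 * s by have := s0; lra.
have eq0 : 0 < e / (2 * s + 1) by rewrite divr_gt0.
pose M := 1 + dot phi phi.
have phiM n : phi n <= M.
  rewrite /M; move: (dot phi phi) (phi n) (coord_le phi n) => D u Du.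
  by have := sqr_ge0 (u - 1); nra.
have [eta eta0 etaP] := powR_uniform M q1 eq0.
have eta2 : 0 < eta ^+ 2 by rewrite exprn_gt0.
apply: filterS (cvg0_lt phis_cvg eta2) => k; rewrite ger0_norm ?dot_ge0// => hk.
have pt n : `|rem k n| <= e * `|(phis k - phi) n|.
  have [c [c0 cphi mvt]] := powR_MVT (2 * s + 1) (phis_gt0 k n) (phi_gt0 n).
  have ceta : `|c - phi n| <= eta.
    apply: le_trans cphi _; rewrite -(@ler_pXn2r _ 2)// ?nnegrE ?(ltW eta0)//.
    rewrite real_normK ?num_real//; apply: le_trans (ltW hk).
    exact: (coord_le (phis k - phi) n).
  have := etaP c (phi n) (ltW c0) _ ceta; rewrite (ltW (phi_gt0 n)) phiM => /(_ isT) h.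
  have -> : rem k n = (2 * s + 1) * (c `^ (2 * s) - phi n `^ (2 * s)) * (phis k - phi) n.
    rewrite remE mvt l2B; have -> : 2 * s + 1 - 1 = 2 * s by ring.
    by move: (phi n) (phis k n) (phi n `^ _) (c `^ _) => a b u v; ring.
  rewrite !normrM (gtr0_norm q0) ler_wpM2r//.
  by rewrite -ler_pdivlMl// [leRHS]mulrC.
have sD := summM (l2P (phis k - phi)) (l2P (phis k - phi)).
rewrite /dot -tsumZ//; apply: le_tsum; [exact: summM (l2P _) (l2P _)|exact: summZ|move=> n].
have := pt n; rewrite -!expr2 -[rem k n ^+ 2]real_normK ?num_real//.
rewrite -[(phis k - phi) n ^+ 2]real_normK ?num_real// -exprMn => h.
by rewrite lerXn2r// nnegrE// mulr_ge0// ltW.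
Qed.

Hypothesis Lp_ker : forall z, Lp z = 0 -> z = 0.

(** [Lp r_k = - phis k + rem k / delta k].  The lower bound [c] on [Lp] first
    yields that [r_k] is bounded, then that [Lp r_k -> - phi], then that [r_k]
    converges in norm to any of its weak limits. *)
Lemma limit_wave_slope : exists2 y : H, Lp y = - phi &
  (dot (phis k) (phis k) - dot phi phi) / delta k @[k --> \oo] --> 2 * dot y phi.
Proof.
have sLp : symmetric_op Lp := Lop_sym w vVp.
have [c c0 cL] : exists2 c : R, 0 < c & forall z, c * dot z z <= dot (Lp z) (Lp z).
  have sL2 : symmetric_op (Lp \o Lp) by move=> a b /=; rewrite !sLp.
  have pL2 : psd_op (Lp \o Lp) by move=> a /=; rewrite sLp dot_ge0.
  have [||c c0 cL] := coercive_of_trivial_kernel sL2 pL2.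
  - exact/weakly_coercive_sqr/Lop_weakly_coercive.
  - by move=> z /Lp_ker/Lp_ker.
  by exists c => // z; rewrite -sLp; exact: cL.
pose r k : H := (delta k)^-1 *: (phis k - phi).
have Lr k : Lp (r k) = (delta k)^-1 *: rem k - phis k.
  rewrite /r (symZ _ _ sLp) /rem (scalerDr _ (Lp (phis k - phi))).
  by rewrite (scalerA _ (delta k)) mulVf// scale1r addrK.
pose M := dot phi phi + 1.
have phisM : \forall k \near \oo, dot (phis k) (phis k) <= M.
  have c1 := strong_norm_cvg phis_cvg.
  by near=> k; apply: ltW; near: k; apply: (cvgr_lt (dot phi phi)) => //; rewrite ltrDl.
(* With this error level the remainder is absorbed by half of the lower bound. *)
pose e1 := Num.sqrt (c / 4).
have e1_gt0 : 0 < e1 by rewrite sqrtr_gt0 divr_gt0.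
have e1E : e1 ^+ 2 = c / 4 by rewrite sqr_sqrtr// ltW// divr_gt0.
have rem_r (e : R) k : dot (rem k) (rem k) <= e ^+ 2 * dot (phis k - phi) (phis k - phi) ->
    dot ((delta k)^-1 *: rem k) ((delta k)^-1 *: rem k) <= e ^+ 2 * dot (r k) (r k).
  have d0 : 0 <= (delta k)^-1 * (delta k)^-1 by rewrite -expr2 sqr_ge0.
  move=> h; rewrite /r !dotZl !dotZr.
  rewrite mulrA; apply: le_trans (ler_wpM2l d0 h) _.
  by rewrite le_eqVlt; apply/orP; left; apply/eqP; ring.
pose B := 4 * M / c.
have r_bd : \forall k \near \oo, dot (r k) (r k) <= B.
  near=> k.
  have h1 : dot (rem k) (rem k) <= e1 ^+ 2 * dot (phis k - phi) (phis k - phi).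
    by near: k; exact: rem_small.
  have h2 : dot (phis k) (phis k) <= M by near: k.
  have := rem_r _ _ h1; have := cL (r k); rewrite Lr.
  have := dotD_le ((delta k)^-1 *: rem k) (- phis k).
  rewrite [dot (- _) _]dotNl [dot _ (- phis k)]dotNr opprK e1E => h3 h4 h5.
  rewrite /B ler_pdivlMr//; lra.
have [U [UU oU]] := ultra_eventually.
(* [r'] agrees with [r] eventually and is bounded from the start. *)
pose r' k := if dot (r k) (r k) <= B then r k else 0.
have r'_bd : bounded_seq r'.
  exists (Num.max B 0) => k; rewrite /r'; case: ifP => h; rewrite ?dot0l le_max ?h ?lexx ?orbT//.
have rr' : \forall k \near \oo, r' k = r k.
  by apply: filterS r_bd => k; rewrite /r' => ->.
have [y ry] := ultra_wcvg UU r'_bd.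
have Lr_cvg : dot (Lp (r k) + phi) (Lp (r k) + phi) @[k --> \oo] --> (0 : R).
  apply/cvgr0Pnorm_lt => e e0.
  have b0 : 0 <= B.
    have [k hk] := filter_ex r_bd; exact: le_trans (dot_ge0 (r k)) hk.
  pose e2 := Num.sqrt (e / (4 * (B + 1))).
  have e2E : e2 ^+ 2 = e / (4 * (B + 1)).
    by rewrite sqr_sqrtr// divr_ge0 ?(ltW e0)//; lra.
  have e2_gt0 : 0 < e2 by rewrite sqrtr_gt0 divr_gt0//; lra.
  have e4 : 0 < e / 4 by rewrite divr_gt0.
  near=> k.
  have h1 : dot (rem k) (rem k) <= e2 ^+ 2 * dot (phis k - phi) (phis k - phi).
    by near: k; exact: rem_small.
  have h2 : `|dot (phis k - phi) (phis k - phi)| < e / 4.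
    by near: k; exact: (cvg0_lt phis_cvg).
  have h3 : dot (r k) (r k) <= B by near: k.
  have -> : Lp (r k) + phi = (delta k)^-1 *: rem k + - (phis k - phi).
    by rewrite Lr -addrA; congr (_ + _); rewrite opprB addrC.
  rewrite ger0_norm ?dot_ge0//; apply: le_lt_trans (dotD_le _ _) _.
  have := rem_r _ _ h1.
  move: h2; rewrite ger0_norm ?dot_ge0//.
  rewrite [dot (- _) _]dotNl [dot _ (- _)]dotNr opprK e2E => h2 h4.
  have : e / (4 * (B + 1)) * dot (r k) (r k) <= e / 4.
    rewrite mulrAC ler_pdivrMr; last by lra.
    have := ler_wpM2l (ltW e0) h3; lra.
  lra.
have Ly : Lp y = - phi.
  apply: dot_ext => h.
  have c1 : dot (Lp (r k)) h @[k --> U] --> dot (Lp y) h.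
    have c1' : wcvg U (fun k => Lp (r' k)) (Lp y) by exact: sym_wcvg.
    apply: cvg_trans (c1' h); apply: near_eq_cvg.
    apply: oU; apply: filterS rr' => k ->; exact: erefl.
  have c2 : dot (Lp (r k)) h @[k --> U] --> dot (- phi) h.
    apply: (cvg_finer oU); apply: (strong_wcvg eventually_filter) => /=.
    by apply: cvg_eq Lr_cvg => k; rewrite opprK.
  exact: (cvg_unique _ c1 c2).
have r_cvg : dot (r k - y) (r k - y) @[k --> \oo] --> (0 : R).
  apply: (@cvg0_le _ _ _ _ (fun k => c^-1 * dot (Lp (r k) + phi) (Lp (r k) + phi))).
    move=> k; rewrite ger0_norm ?dot_ge0// ler_pdivlMl//; apply: le_trans (cL _) _.
    by rewrite (symB _ _ sLp) Ly opprK.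
  by rewrite -[X in _ --> X](mulr0 c^-1); apply: cvgM => //; exact: cvg_cst.
exists y => //.
apply: (cvg_eq (f := fun k => 2 * dot (r k) phi + delta k * dot (r k) (r k))).
  move=> k; have -> : phis k = phi + delta k *: r k.
    by rewrite /r scalerA mulfV// scale1r addrC subrK.
  have dk := delta_neq0 k.
  by move: (r k) (phi : H) => z f; rewrite !dotE (dotC f z); field.
rewrite -[X in _ --> X](_ : 2 * dot y phi + 0 * dot y y = _); last by rewrite mul0r addr0.
apply: cvgD; apply: cvgM => //; [exact: cvg_cst| |exact: strong_norm_cvg].
exact: (strong_wcvg eventually_filter r_cvg).
Unshelve. all: end_near. Qed.

End LimitWave.

(** * Complex eigenpairs *)

Section RealSpectrum.
Variables (R : realType) (T : choiceType).
Local Notation H := (l2 R T).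
Variables (Lp Lm : H -> H) (phi : H).
Hypotheses (sLp : symmetric_op Lp) (sLm : symmetric_op Lm).
Hypotheses (Lm_phi : Lm phi = 0) (pLm : psd_op Lm).
Hypothesis Lp_nonneg : forall z, dot z phi = 0 -> 0 <= dot (Lp z) z.

(** The four equations are the real form of [- Lm v2 = mu v1], [Lp v1 = mu v2]
    with [mu = al + i be], [v1 = a + i b] and [v2 = c + i e].  Pairing the first
    with [phi] gives [a] and [b] orthogonal to [phi].  With
    [X = <a, c> + <b, e>] and [Y = <b, c> - <a, e>], symmetry of [Lp] and of
    [Lm] gives [al Y = be X] and [al Y = - be X], so [Y = 0], while
    the forms of [Lp] on [v1] and of [Lm] on [v2] are [al X + be Y] and
    [- al X + be Y].  Both are nonnegative, hence both vanish and [Lm v2 = 0]. *)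
Lemma no_unstable_mode (al be : R) (a b c e : H) : 0 < al ->
  - Lm c = al *: a - be *: b -> - Lm e = al *: b + be *: a ->
  Lp a = al *: c - be *: e -> Lp b = al *: e + be *: c ->
  [/\ a = 0, b = 0, c = 0 & e = 0].
Proof.
move=> al0 Ec Ee Ea Eb.
have n0 : 0 < al ^+ 2 + be ^+ 2 by have := sqr_ge0 be; nra.
have solve0 (p q : H) : al *: p - be *: q = 0 -> al *: q + be *: p = 0 -> p = 0 /\ q = 0.
  move=> h1 h2.
  have hp : (al ^+ 2 + be ^+ 2) *: p = al *: (al *: p - be *: q) + be *: (al *: q + be *: p).
    by apply: l2_ext => n; rewrite !l2E; ring.
  have hq : (al ^+ 2 + be ^+ 2) *: q = al *: (al *: q + be *: p) - be *: (al *: p - be *: q).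
    by apply: l2_ext => n; rewrite !l2E; ring.
  move: hp hq; rewrite h1 h2 !scaler0 addr0 subr0 => /eqP hp /eqP hq.
  move: hp hq; rewrite !scaler_eq0 (gt_eqF n0)/= => /eqP hp /eqP hq //.
have perp (p q : H) : al * dot p phi - be * dot q phi = 0 ->
    al * dot q phi + be * dot p phi = 0 -> dot p phi = 0.
  move=> h1 h2; have : (al ^+ 2 + be ^+ 2) * dot p phi = 0.
    transitivity (al * (al * dot p phi - be * dot q phi) +
      be * (al * dot q phi + be * dot p phi)); first by ring.
    by rewrite h1 h2 !mulr0 addr0.
  by move/eqP; rewrite mulf_eq0 (gt_eqF n0) => /eqP.
have h1 : al * dot a phi - be * dot b phi = 0.
  by rewrite -!dotZl -dotBl -Ec dotNl sLm Lm_phi dot0r oppr0.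
have h2 : al * dot b phi + be * dot a phi = 0.
  by rewrite -!dotZl -dotDl -Ee dotNl sLm Lm_phi dot0r oppr0.
have a_perp := perp _ _ h1 h2.
have b_perp : dot b phi = 0.
  by move: h2; rewrite a_perp mulr0 addr0 => /eqP; rewrite mulf_eq0 (gt_eqF al0) => /eqP.
have Lma : dot (Lp a) a = al * dot a c - be * dot a e.
  by rewrite Ea !dotE (dotC c) (dotC e).
have Lmb : dot (Lp b) b = al * dot b e + be * dot b c.
  by rewrite Eb !dotE (dotC e) (dotC c).
have Lab : al * dot b c - be * dot b e = al * dot a e + be * dot a c.
  have := sLp a b; rewrite Ea Eb !dotE (dotC c) (dotC e); lra.
have Mc : dot (Lm c) c = - (al * dot a c - be * dot b c).
  by rewrite -[Lm c]opprK Ec !dotE.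
have Me : dot (Lm e) e = - (al * dot b e + be * dot a e).
  by rewrite -[Lm e]opprK Ee !dotE.
have Mce : al * dot a e - be * dot b e = al * dot b c + be * dot a c.
  have := sLm c e; rewrite -[Lm c]opprK -[Lm e]opprK Ec Ee !dotE.
  rewrite (dotC c b) (dotC c a); lra.
have pa := Lp_nonneg a_perp; have pb := Lp_nonneg b_perp.
have pc := pLm c; have pe := pLm e.
set X := dot a c + dot b e; set Y := dot b c - dot a e.
have alY : al * Y = 0 by rewrite /Y; lra.
have Y0 : Y = 0 by move/eqP: alY; rewrite mulf_eq0 (gt_eqF al0) => /eqP.
have bY : be * Y = 0 by rewrite Y0 mulr0.
have c0 : dot (Lm c) c = 0 by move: bY; rewrite /Y; lra.
have e0 : dot (Lm e) e = 0 by move: bY; rewrite /Y; lra.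
have Lc := psd_ker sLm pLm c0; have Le := psd_ker sLm pLm e0.
rewrite Lc oppr0 in Ec; rewrite Le oppr0 in Ee.
have [a0 b0] := solve0 a b (esym Ec) (esym Ee).
rewrite a0 (sym0 sLp) in Ea; rewrite b0 (sym0 sLp) in Eb.
have [c00 e00] := solve0 c e (esym Ea) (esym Eb).
by split.
Qed.

End RealSpectrum.

Section Complexification.
Variables (R : realType) (d : nat).
Local Notation L := (lattice d).
Local Notation H := (l2 R L).
Local Open Scope complex_scope.
Implicit Types (v : L -> R[i]) (V : L -> R) (x : H) (w : R).

Lemma laplacian_morph (V W : zmodType) (f : V -> W) (u : L -> V) n :
  {morph f : a b / a + b} -> f (laplacian u n) = laplacian (f \o u) n.
Proof.
move=> fD; have f0 : f 0 = 0 by apply: (addIr (f 0)); rewrite -fD !add0r.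
have fN a : f (- a) = - f a by apply/eqP; rewrite -addr_eq0 -fD addNr f0.
have fMn a k : f (a *+ k) = f a *+ k.
  by elim: k => [|k IH]; rewrite ?mulr0n// !mulrS fD IH.
by rewrite !laplacianE fD fN fMn (big_morph f fD f0).
Qed.

Definition re v (n : L) : R := complex.Re (v n).
Definition im v (n : L) : R := complex.Im (v n).

Lemma ReD (a b : R[i]) : complex.Re (a + b) = complex.Re a + complex.Re b.
Proof. by case: a; case: b. Qed.

Lemma ImD (a b : R[i]) : complex.Im (a + b) = complex.Im a + complex.Im b.
Proof. by case: a; case: b. Qed.

Lemma ReM (a b : R[i]) : complex.Re (a * b) =
  complex.Re a * complex.Re b - complex.Im a * complex.Im b.
Proof. by case: a; case: b. Qed.

Lemma ImM (a b : R[i]) : complex.Im (a * b) =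
  complex.Re a * complex.Im b + complex.Im a * complex.Re b.
Proof. by case: a => p q; case: b. Qed.

Lemma ReN (a : R[i]) : complex.Re (- a) = - complex.Re a.
Proof. by case: a. Qed.

Lemma ImN (a : R[i]) : complex.Im (- a) = - complex.Im a.
Proof. by case: a. Qed.

Definition schroedingerC w V v n : R[i] :=
  - laplacian v n + w%:C * v n - (V n)%:C * v n.

Lemma Re_schroedinger w V v n : vanishing V -> re v \in @sqsumm R L ->
  complex.Re (schroedingerC w V v n) = Lop w V (toL2 (re v)) n.
Proof.
move=> vV sv; rewrite LopE// toL2E// !ReD !ReN !ReM /= !mul0r !subr0.
by rewrite (laplacian_morph v n ReD).
Qed.

Lemma Im_schroedinger w V v n : vanishing V -> im v \in @sqsumm R L ->
  complex.Im (schroedingerC w V v n) = Lop w V (toL2 (im v)) n.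
Proof.
move=> vV sv; rewrite LopE// toL2E// !ImD !ImN !ImM /= !mul0r !addr0.
by rewrite (laplacian_morph v n ImD).
Qed.

Lemma mem_l2C_parts v : mem_l2C v -> re v \in @sqsumm R L /\ im v \in @sqsumm R L.
Proof.
move=> /mem_lp2P sv; split; apply: sqsumm_le sv => n; rewrite [leRHS]ger0_norm;
  rewrite /re /im /ComplexField.Normc.normc; case: (v n) => a b //=; rewrite ?sqrtr_ge0//.
  by rewrite -sqrtr_sqr ler_wsqrtr// lerDl sqr_ge0.
by rewrite -sqrtr_sqr ler_wsqrtr// lerDr sqr_ge0.
Qed.

Lemma mem_l2C_real x : mem_l2C (fun n => (x n)%:C).
Proof.
apply/mem_lp2P; apply: sqsumm_le (l2P x) => n.
by rewrite /ComplexField.Normc.normc/= expr0n addr0 sqrtr_sqr normr_id.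
Qed.

Lemma schroedinger_real w V x n : vanishing V ->
  schroedingerC w V (fun n => (x n)%:C) n = (Lop w V x n)%:C.
Proof.
move=> vV; rewrite LopE// /schroedingerC.
have cD : {morph (fun z : R => z%:C) : a b / a + b} by move=> a b; rewrite rmorphD.
rewrite -[laplacian _ n](laplacian_morph x n cD).
by move: (laplacian x n) => a; rewrite !rmorphD !rmorphN !rmorphM.
Qed.

Variables (s w : R) (phi : H).
Hypotheses (s0 : 0 < s) (w0 : 0 < w) (phi_gt0 : forall n, 0 < phi n).

Let phi_ge0 n : 0 <= phi n. Proof. exact: ltW. Qed.
Let Vm := potential s phi.
Let Vp := potential_plus s phi.
Let vVm : vanishing Vm. Proof. exact: potential_vanishing. Qed.
Let vVp : vanishing Vp. Proof. exact: potential_plus_vanishing. Qed.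
Let Lm := Lop w Vm : H -> H.
Let Lp := Lop w Vp : H -> H.

Lemma nondegenerate_ker : nondegenerate_wave s w phi -> forall z, Lp z = 0 -> z = 0.
Proof.
move=> /seteqP[nd _] z Lz.
have /nd zz : [set v | mem_l2C v /\ Lplus s w phi v = cst 0] (fun n => (z n)%:C).
  split; first exact: mem_l2C_real.
  apply/funext => n; rewrite -[LHS]/(schroedingerC w Vp (fun n => (z n)%:C) n).
  by rewrite schroedinger_real// -/Lp Lz l20.
apply: l2_ext => n; rewrite l20.
have := congr1 (fun f : L -> R[i] => complex.Re (f n)) zz; by [].
Qed.

Hypothesis phi_eq : forall n, Aop w phi n = phi n `^ (2 * s + 1).

Lemma Lminus_phi : Lm phi = 0.
Proof.
apply: l2_ext => n; rewrite l20 /Lm /Lop l2B mulL2E// phi_eq /Vm /potential.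
rewrite powRD ?powRr1 ?subrr//; apply/implyP => _; exact: lt0r_neq0.
Qed.

Lemma Lplus_phi : Lp phi = - (2 * s) *: mulL2 Vm phi.
Proof.
have e : Lp phi = Lm phi - (2 * s) *: mulL2 Vm phi.
  apply: l2_ext => n; rewrite [in RHS]l2B [in RHS]l2Z /Lp /Lm.
  rewrite [in LHS]LopE// [in RHS]LopE// mulL2E//.
  rewrite /Vp /potential_plus -/Vm; ring.
by rewrite e Lminus_phi sub0r scaleNr.
Qed.

Lemma phi_psi_gt0 : 0 < dot phi (mulL2 Vm phi).
Proof.
have -> : mulL2 Vm phi = Aop w phi.
  by apply/esym/eqP; rewrite -subr_eq0; apply/eqP; exact: Lminus_phi.
rewrite dotC; apply: lt_le_trans (Aop_ge w phi).
rewrite mulr_gt0//; apply: lt_le_trans (coord_le phi 0).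
by rewrite exprn_gt0.
Qed.

Let Lm_psd : psd_op Lm.
Proof. exact: (Lop_psd vVm phi_gt0 Lminus_phi). Qed.

Lemma spectrally_stable_of_nonneg :
  (forall z, dot z phi = 0 -> 0 <= dot (Lp z) z) -> spectrally_stable s w phi.
Proof.
move=> nn [mu [[v1 v2] [mu0 [/= m1 m2 vn0 e1 e2]]]]; apply: vn0.
have [r1 i1] := mem_l2C_parts m1; have [r2 i2] := mem_l2C_parts m2.
have [||||a0 b0 c0 e0] := no_unstable_mode (Lop_sym w vVp) (Lop_sym w vVm)
  Lminus_phi Lm_psd nn mu0 (be := complex.Im mu) (a := toL2 (re v1)) (b := toL2 (im v1))
  (c := toL2 (re v2)) (e := toL2 (im v2)).
- apply: l2_ext => n; rewrite [in LHS]l2N [in RHS]l2B !l2Z -Re_schroedinger// !toL2E// -ReN.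
  by rewrite -[schroedingerC _ _ _ _]/(Lminus s w phi v2 n) e1 ReM.
- apply: l2_ext => n; rewrite [in LHS]l2N [in RHS]l2D !l2Z -Im_schroedinger// !toL2E// -ImN.
  by rewrite -[schroedingerC _ _ _ _]/(Lminus s w phi v2 n) e1 ImM.
- apply: l2_ext => n; rewrite [in RHS]l2B !l2Z -Re_schroedinger// !toL2E//.
  by rewrite -[schroedingerC _ _ _ _]/(Lplus s w phi v1 n) e2 ReM.
- apply: l2_ext => n; rewrite [in RHS]l2D !l2Z -Im_schroedinger// !toL2E//.
  by rewrite -[schroedingerC _ _ _ _]/(Lplus s w phi v1 n) e2 ImM.
have z (v : L -> R[i]) : re v \in @sqsumm R L -> im v \in @sqsumm R L ->
    toL2 (re v) = 0 -> toL2 (im v) = 0 -> v = cst 0.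
  move=> sr si rv iv; apply/funext => n; rewrite /cst.
  have : re v n = 0 by rewrite -(toL2E sr) rv.
  have : im v n = 0 by rewrite -(toL2E si) iv.
  by rewrite /re /im; case: (v n) => p q /= -> ->.
by rewrite (z v1)// (z v2).
Qed.

(** The eigenvector is [(x, mu^-1 Lp x)], with real eigenvalue [mu]. *)
Lemma spectrally_unstable_of_mode (mu : R) x : 0 < mu -> x != 0 ->
  Lm (Lp x) = - mu ^+ 2 *: x -> spectrally_unstable s w phi.
Proof.
move=> mu0 x0 LL; apply; exists mu%:C.
have [z zE] : exists z, z = mu^-1 *: Lp x by exists (mu^-1 *: Lp x).
have Lmz : Lm z = - mu *: x.
  have sLm : symmetric_op Lm := Lop_sym w vVm.
  rewrite zE (symZ _ _ sLm) LL scalerA; congr (_ *: _); field; exact: lt0r_neq0.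
have Lpx : Lp x = mu *: z by rewrite zE scalerA mulfV ?scale1r// lt0r_neq0.
exists (fun n => (x n)%:C, fun n => (z n)%:C); split => //.
split.
- exact: mem_l2C_real.
- exact: mem_l2C_real.
- move=> [xe _]; move/eqP: x0; apply; apply: l2_ext => n; rewrite l20.
  by have := congr1 (fun f : L -> R[i] => complex.Re (f n)) xe.
- move=> n; rewrite -[Lminus _ _ _ _ _]/(schroedingerC w Vm (fun n => (z n)%:C) n).
  rewrite schroedinger_real// -/Lm Lmz l2Z.
  by rewrite -rmorphN mulNr opprK rmorphM.
- move=> n; rewrite -[Lplus _ _ _ _ _]/(schroedingerC w Vp (fun n => (x n)%:C) n).
  by rewrite schroedinger_real// -/Lp Lpx l2Z rmorphM.
Qed.

End Complexification.

(** * Stability criterion *)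

Theorem theorem4 (R : realType) (d : nat) (sigma omega : R)
    (delta : nat -> R) (phis : nat -> lattice d -> R) (phi : lattice d -> R)
    (hd : (1 <= d)%N) (hsigma : 0 < sigma) (homega : 0 < omega)
    (hphi : limit_wave sigma omega delta phis phi)
    (hker : nondegenerate_wave sigma omega phi) :
  exists l : R,
    [/\ (lp_norm 2 (phis k) ^+ 2 - lp_norm 2 phi ^+ 2) / delta k
          @[k --> \oo] --> l,
        0 <= l -> spectrally_stable sigma omega phi
      & l < 0 -> spectrally_unstable sigma omega phi].
Proof.
have [us [u [[[delta_neq0 delta_cvg] w_delta us_min /mem_lp2P su us_cvg] phiE phisE]]] := hphi.
have sus k : us k \in @sqsumm R (lattice d).
  by have [[/mem_lp2P]] := us_min k.
pose xs k := toL2 (us k); pose x := toL2 u.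
have xsE k : l2_val (xs k) = us k by exact: toL2E.
have xE : l2_val x = u by exact: toL2E.
have xs_ge0 k n : 0 <= xs k n by rewrite xsE; have [_ _] := us_min k.
have xs_adm k : pow_sum sigma (xs k) = 1.
  by apply/(admissibleP hsigma); rewrite xsE; have [] := us_min k.
have xs_min k : dot (Aop (omega + delta k) (xs k)) (xs k) = J_inf d sigma (omega + delta k).
  by rewrite -JE xsE; have [] := us_min k.
have xs_cvg : dot (xs k - x) (xs k - x) @[k --> \oo] --> (0 : R).
  apply: (cvg_eq (f := fun k => lp_norm 2 (us k \- u) * lp_norm 2 (us k \- u))).
    move=> k; rewrite -expr2 -lp_norm2E; congr (lp_norm 2 _ ^+ 2).
    by apply/funext => n; rewrite l2B xsE xE.
  by rewrite -[X in _ --> X](mulr0 (0 : R)); apply: cvgM.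
pose f := wave_factor d sigma omega *: x.
have fE : phi = l2_val f by rewrite phiE; apply/funext => n; rewrite l2Z xE.
pose fs k := wave_factor d sigma (omega + delta k) *: xs k.
have fsE k : phis k = l2_val (fs k).
  by rewrite phisE; apply/funext => n; rewrite l2Z xsE.
have x_ge0 := limit_ge0 xs_ge0 xs_cvg.
have x_adm := limit_admissible hsigma homega delta_cvg w_delta xs_ge0 xs_adm xs_min xs_cvg.
have x_min := limit_energy hsigma homega delta_cvg w_delta xs_adm xs_min xs_cvg.
have f_gt0 : forall n, 0 < f n := minimizer_wave_gt0 hsigma homega x_ge0 x_adm x_min.
have f_eq := minimizer_wave_equation hsigma homega x_ge0 x_adm x_min.
rewrite fE in hker *.
have ker := nondegenerate_ker hsigma f_gt0 hker.
have [y Ly slope] := limit_wave_slope hsigma homega delta_neq0 delta_cvg w_delta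
  xs_ge0 xs_adm xs_min xs_cvg ker.
have f_ge0 n : 0 <= f n by exact: ltW.
have vVm := potential_vanishing hsigma f_ge0.
have vVp := potential_plus_vanishing hsigma f_ge0.
have sLp := Lop_sym omega vVp; have sLm := Lop_sym omega vVm.
have Lmf := Lminus_phi hsigma f_gt0 f_eq.
have Lpf := Lplus_phi hsigma f_gt0 f_eq.
have pos := phi_psi_gt0 hsigma homega f_gt0 f_eq.
have pLm := Lop_psd vVm f_gt0 Lmf.
have index := minimizer_wave_index hsigma homega x_ge0 x_adm x_min.
have kappa0 : 0 < 2 * sigma by rewrite mulr_gt0.
have Ly' : Lop omega (potential_plus sigma f) (- y) = f.
  by rewrite -sub0r (symB _ _ sLp) (sym0 sLp) Ly sub0r opprK.
exists (2 * dot y f); split.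
- rewrite [X in X @ _](_ : _ = fun k => (dot (fs k) (fs k) - dot f f) / delta k).
    exact: slope.
  apply/funext => k; congr ((_ - _) / _); last exact: (lp_norm2E f).
  by rewrite fsE; exact: (lp_norm2E (fs k)).
- move=> l0; apply: (spectrally_stable_of_nonneg hsigma f_gt0 f_eq) => z z0.
  apply: (vk_nonneg sLp index Lpf pos Ly' _ z0).
  by rewrite dotNl oppr_le0 -(@pmulr_rge0 _ 2).
- move=> l0; have [C1 C10 bLp] := Lop_bound homega vVp.
  have [C2 C20 bLm] := Lop_bound homega vVm.
  have y0 : 0 < dot (- y) f by rewrite dotNl oppr_gt0 -(@pmulr_rlt0 _ 2).
  have le1 z : `|dot (Lop omega (potential_plus sigma f) z) z| <= (C1 + C2) * dot z z.
    by apply: le_trans (bLp z) _; rewrite ler_wpM2r ?dot_ge0// lerDl.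
  have le2 z : dot (Lop omega (potential sigma f) z) z <= (C1 + C2) * dot z z.
    apply: le_trans (ler_norm _) _; apply: le_trans (bLm z) _.
    by rewrite ler_wpM2r ?dot_ge0// lerDr.
  have [mu [v [mu0 v0 LL]]] := vk_growing_mode sLp sLm Lmf pLm kappa0 Lpf pos
    (Lop_ker vVm f_gt0 Lmf) le1 le2 (Lop_weakly_coercive homega vVp)
    (Lop_weakly_coercive homega vVm) Ly' y0.
  exact: (spectrally_unstable_of_mode hsigma f_gt0 mu0 v0 LL).
Qed.
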